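(* Let $U$ be a bounded open convex subset of a uniformly convex Banach space $(E,\|\cdot\|)$ with $0\in U$. Assume $F:\overline U\to E$ is a semicontractive and continuous single-valued mapping. In addition, assume that for any $x\in\partial\overline U$ one has $\lambda x\ne F(x)$ for every $\lambda>1$ (the Leray-Schauder boundary condition). Then $F$ has at least one fixed point.
   Context: Let $D$ be a nonempty bounded closed subset of a Banach space $E$. A mapping $f:D\to E$ is semicontractive if there is a mapping $V:D\times D\to E$ with $f(x)=V(x,x)$ for each $x\in D$ such that (a) for each fixed $x\in D$, $V(\cdot,x)$ is nonexpansive from $D$ to $E$, i.e. $\|V(u,x)-V(v,x)\|\le\|u-v\|$ for all $u,v\in D$; and (b) for each fixed $x\in D$, $V(x,\cdot)$ is completely continuous from $D$ to $E$, uniformly for the first variable in bounded subsets of $D$, meaning: if $v_j$ converges weakly to $v$ in $D$ and $(u_j)$ is a bounded sequence in $D$, then $V(u_j,v_j)-V(u_j,v)\to 0$ strongly. *)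

(* Defs.v *)
From HB Require Import structures.
From mathcomp Require Import all_boot all_order all_algebra.
From mathcomp Require Import all_classical all_reals all_analysis.

Set Implicit Arguments.
Unset Strict Implicit.
Unset Printing Implicit Defensive.

Import Order.TTheory GRing.Theory Num.Theory.
Import numFieldNormedType.Exports.

Local Open Scope classical_set_scope.
Local Open Scope ring_scope.

(* Closed-unit-ball form of uniform convexity; eps > 2 is vacuous. *)
Definition uniformly_convex (R : realType) (E : normedModType R) : Prop :=
  forall eps : R, 0 < eps ->
    exists2 delta : R, 0 < delta &
      forall x y : E, `|x| <= 1 -> `|y| <= 1 -> eps <= `|x - y| ->
        `|2^-1 *: (x + y)| <= 1 - delta.

Definition weakly_converges (R : realType) (E : normedModType R)
    (v : nat -> E) (l : E) : Prop :=
  forall phi : {linear E -> R^o}, continuous phi ->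
    phi (v n) @[n --> \oo] --> phi l.

Definition boundary (T : topologicalType) (A : set T) : set T :=
  closure A `\` interior A.

(* Maps D -> E and D * D -> E are represented by total functions of which only
   the values on D, resp. D * D, are ever constrained. *)
Definition nonexpansive_on (R : realType) (E : normedModType R)
    (D : set E) (g : E -> E) : Prop :=
  forall u v, D u -> D v -> `|g u - g v| <= `|u - v|.

Definition completely_continuous_uniformly (R : realType)
    (E : normedModType R) (D : set E) (V : E -> E -> E) : Prop :=
  forall (u v : nat -> E) (l : E),
    (forall j, D (u j)) -> bounded_set (range u) ->
    (forall j, D (v j)) -> D l -> weakly_converges v l ->
    V (u j) (v j) - V (u j) l @[j --> \oo] --> (0 : E).

(* Intended for D nonempty, bounded and closed. *)
Definition semicontractive (R : realType) (E : normedModType R)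
    (D : set E) (f : E -> E) : Prop :=
  exists V : E -> E -> E,
    [/\ forall x, D x -> f x = V x x,
        forall x, D x -> nonexpansive_on D (fun u => V u x) &
        completely_continuous_uniformly D V].

(* Main.v *)
Require Import Defs.
From HB Require Import structures.
From mathcomp Require Import all_boot all_order all_algebra.
From mathcomp Require Import all_classical all_reals all_analysis.
From mathcomp Require Import zify ring lra.

Set Implicit Arguments.
Unset Strict Implicit.
Unset Printing Implicit Defensive.

Import Order.TTheory GRing.Theory Num.Theory.
Import numFieldNormedType.Exports.

(** Write C for the closure of U and F x = V x x.  For 0 < t < 1 the map t F
    shrinks noncompactness by the factor t: the first slot of V is nonexpansive,
    and the second one ranges over a precompact family of maps, because bounded
    sequences have weakly convergent subsequences and V is completely continuous
    there.  Let r be the radial retraction of E onto C given by the gauge of C.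
    It moves points along rays towards 0, so r (t F) sends C into itself and
    remains condensing: the closed convex hull of 0 and of the image of A is at
    most t times as noncompact as A.  The least closed convex set containing 0 and
    invariant under r (t F) is therefore totally bounded, and Schauder's theorem on
    it gives x = r (t F x) ([leray_schauder_scaled]).  If t F x were outside C, then x would be on the
    boundary with lambda x = F x for some lambda > 1, which the Leray-Schauder
    condition excludes; hence x = t F x.

    Letting t tend to 1 gives points x_k with x_k - F x_k -> 0.  Along a weakly
    convergent subsequence, with limit l, complete continuity gives
    x_k - V x_k l -> 0, and demiclosedness of the identity minus the nonexpansive
    map u |-> V u l ([demiclosed]) gives l = V l l = F l.

    Weak convergence only enters through convex hulls.  Say that v hull-converges
    to l when l is in the closed convex hull of every subsequence of v.  This
    implies weak convergence, and it is also what Mazur's theorem would give back.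
    In a uniformly convex Banach space a bounded sequence has a hull-convergent
    subsequence ([bounded_hull_cvg_subsequence]): choose the subsequence so that the limit of
    the minimal norms of the hulls of its tails cannot be increased by passing to
    a further subsequence; nearly minimal points of all these hulls then
    accumulate at a single point.

    Schauder's theorem comes from a combinatorial lemma of Scarf type ([scarf]),
    proved by a parity count over finite sets equipped with several linear orders.
    A grid point of the simplex spanned by a finite net is coloured by a net point
    close to its image; a cell carrying all the colours of its face is then close
    to the convex hull of the images of its own points
    ([approximate_fixed_point]). *)

(** * A combinatorial lemma of Scarf type *)

Section DominatedSets.
Import boot.fintype boot.finset.
Variables (W I : finType) (key : I -> W -> nat) (g : W -> I).
Hypothesis key_inj : forall i, injective (key i).
Local Open Scope nat_scope.
Implicit Types (Z : {set W}) (i k l : I) (w y z : W).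

(** The linear orders given by the keys play the role of barycentric
    coordinates: nothing lies strictly above Z in all of them at once.  Dominated
    sets with #|I| elements are the rooms and those with one element less are the
    doors of the parity argument. *)
Definition dominated Z :=
  [forall y, [exists i, [forall z in Z, key i y <= key i z]]].

Lemma dominatedP Z :
  reflect (forall y, exists i, forall z, z \in Z -> key i y <= key i z)
          (dominated Z).
Proof.
apply: (iffP forallP) => h y.
  by have /existsP[i /forall_inP hi] := h y; exists i.
by have [i hi] := h y; apply/existsP; exists i; apply/forall_inP.
Qed.

Lemma dominatedS Z Z' : Z \subset Z' -> dominated Z' -> dominated Z.
Proof.
move=> /subsetP sZ /dominatedP h; apply/dominatedP => y.
by have [i hi] := h y; exists i => z /sZ /hi.
Qed.

Lemma exists_argmin Z i : Z != set0 ->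
  exists z, z \in Z /\ forall z', z' \in Z -> key i z <= key i z'.
Proof.
case/set0Pn => z0 z0Z.
by case: (@arg_minnP _ z0 (mem Z) (key i) z0Z) => z zZ hz; exists z.
Qed.

Lemma exists_argmin_fun Z : Z != set0 ->
  {mn : I -> W & forall i,
    mn i \in Z /\ forall z, z \in Z -> key i (mn i) <= key i z}.
Proof. by move=> Z0; exact: (choice (fun i => exists_argmin i Z0)). Qed.

(** A door has one element less than there are orders, so exactly two orders
    i and j have the same least element on Z.  Giving up one of them, say k, frees
    the region above all the other minima; its highest point for the order k is
    the only point that completes Z to a room in which k regains an own minimum.
    The two choices of k give two different rooms. *)
Lemma card_door_rooms Z : dominated Z -> #|Z|.+1 = #|I| -> Z != set0 ->
    (forall k, exists y, forall l, l != k ->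
       exists2 z, z \in Z & key l z < key l y) ->
  #|[set w | (w \notin Z) && dominated (w |: Z)]| = 2.
Proof.
move=> /dominatedP dZ cZ Z0 room_above.
have [mn mnP] := exists_argmin_fun Z0.
have mnZ i : mn i \in Z by case: (mnP i).
have mn_le i z : z \in Z -> key i (mn i) <= key i z by case: (mnP i) => _; apply.
have mnT : mn @: [set: I] = Z.
  apply/setP => z; apply/imsetP/idP => [[i _ ->]//|zZ].
  have [i hi] := dZ z; exists i => //; apply: (@key_inj i).
  by apply/eqP; rewrite eqn_leq mn_le// hi.
(* the map sending an order to its least element is onto Z, one index too many *)
have [i [j [ij mnij]]] : exists i, exists j, i != j /\ mn i = mn j.
  have /imset_injP : #|mn @: [set: I]| != #|[set: I]|.
    by rewrite mnT cardsT -cZ neq_ltn ltnSn.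
  move=> ninj; apply: contrapT => h; apply: ninj => i j _ _ e.
  by case: (eqVneq i j) => // ij; case: h; exists i, j.
pose dup k := k \in [set i; j].
have mn_other k z : dup k -> z \in Z -> exists2 l, l != k & mn l = z.
  move=> dk; rewrite -mnT => /imsetP[l _ ->].
  have [->|lk] := eqVneq l k; last by exists l.
  move: dk; rewrite /dup !inE => /orP[]/eqP->; first by exists j; rewrite // eq_sym.
  by exists i.
have dup_of_inj k : (forall l l', l != k -> l' != k -> mn l = mn l' -> l = l') ->
    dup k.
  move=> h; rewrite /dup !inE; apply/orP.
  case: (eqVneq k i) => [|ki]; first by left.
  case: (eqVneq k j) => [|kj]; first by right.
  by move/eqP: ij; case; apply: h; rewrite // eq_sym.
pose M k := [set y | [forall l, (l != k) ==> (key l (mn l) < key l y)]].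
have MP k y : reflect (forall l, l != k -> key l (mn l) < key l y) (y \in M k).
  rewrite inE; apply: (iffP forallP) => [h l lk|h l].
    by have /implyP := h l; apply.
  by apply/implyP; apply: h.
have [top topP] : {top : I -> W & forall k,
    top k \in M k /\ forall y, y \in M k -> key k y <= key k (top k)}.
  apply: (@choice _ _ (fun k w => w \in M k /\
    forall y, y \in M k -> key k y <= key k w)) => k.
  have [y0 hy0] := room_above k.
  have y0M : y0 \in M k.
    apply/MP => l /hy0[z zZ]; apply: leq_ltn_trans; exact: mn_le.
  by case: (@arg_maxnP _ y0 (mem (M k)) (key k) y0M) => y yM hy; exists y.
have top_notin k : dup k -> top k \notin Z.
  move=> dk; apply/negP => /(mn_other _ _ dk)[l lk e].
  by have /MP/(_ l lk) := (topP k).1; rewrite e ltnn.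
have top_dom k : dup k -> dominated (top k |: Z).
  move=> dk; apply/dominatedP => y.
  have [yM|yM] := boolP (y \in M k).
    have [i0 hi0] := dZ y.
    exists k => z; rewrite !inE => /orP[/eqP->|zZ]; first exact: (topP k).2.
    have [e|ne] := eqVneq i0 k; first by rewrite -e; exact: hi0.
    have /MP/(_ i0 ne) := yM; rewrite ltnNge hi0//.
  have [l lk hl] : exists2 l, l != k & key l y <= key l (mn l).
    move: yM; rewrite inE negb_forall => /existsP[l].
    by rewrite negb_imply -leqNgt => /andP[lk hl]; exists l.
  exists l => z; rewrite !inE => /orP[/eqP->|zZ].
    by apply: leq_trans hl _; apply: ltnW; have /MP/(_ l lk) := (topP k).1.
  exact: leq_trans hl (mn_le _ _ zZ).
have is_top w : w \notin Z -> dominated (w |: Z) -> exists2 k, dup k & w = top k.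
  move=> wZ /dominatedP dw.
  have [k hk] := dw w.
  have wlt z : z \in Z -> key k w < key k z.
    move=> zZ; rewrite ltn_neqAle hk ?inE ?zZ ?orbT// andbT.
    by apply: contraNneq wZ => /key_inj ->.
  (* each element of Z is the least of [w |: Z] for an index other than k *)
  have own z : z \in Z -> exists2 l, l != k & z = mn l /\ key l z < key l w.
    move=> zZ; have [l hl] := dw z.
    have lk : l != k.
      apply: contraTneq (wlt _ zZ) => <-; rewrite -leqNgt hl//.
      by rewrite !inE eqxx.
    exists l => //; split.
      apply: (@key_inj l); apply/eqP; rewrite eqn_leq mn_le// hl//.
      by rewrite !inE mnZ orbT.
    rewrite ltn_neqAle hl ?inE ?eqxx// andbT.
    by apply: contraNneq wZ => /key_inj <-.
  have imk : mn @: [set~ k] = Z.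
    apply/setP => z; apply/imsetP/idP => [[l _ ->]//|/own[l lk [-> _]]].
    by exists l => //; rewrite !inE.
  have injk : {in [set~ k] &, injective mn}.
    by apply/imset_injP; rewrite imk cardsC1 -cZ.
  have dk : dup k.
    by apply: dup_of_inj => l l' lk l'k; apply: injk; rewrite !inE.
  have wM : w \in M k.
    apply/MP => l lk; have [l' l'k [e lt]] := own _ (mnZ l).
    have ll : l = l' by apply: injk; rewrite ?inE.
    by subst l'.
  exists k => //; apply: (@key_inj k); apply/eqP.
  rewrite eqn_leq (topP k).2//=.
  have [l hl] := dw (top k).
  have [lk|lk] := eqVneq l k.
    by rewrite -{1 3}lk hl// !inE eqxx.
  have /MP/(_ l lk) := (topP k).1.
  by rewrite ltnNge hl// !inE mnZ orbT.
have di : dup i by rewrite /dup !inE eqxx.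
have dj : dup j by rewrite /dup !inE eqxx orbT.
have topij : top i != top j.
  apply/eqP => e.
  have [l hl] := dZ (top i).
  have : key l (mn l) < key l (top i).
    have [li|li] := eqVneq l i; last by have /MP/(_ l li) := (topP i).1.
    rewrite e; have /MP := (topP j).1; apply; by rewrite li.
  by rewrite ltnNge hl.
suff -> : [set w | (w \notin Z) && dominated (w |: Z)] = [set top i; top j].
  by rewrite cards2 topij.
apply/setP => w; rewrite !inE; apply/idP/idP.
  move=> /andP[wZ /(is_top _ wZ)[k]]; rewrite /dup !inE.
  by move=> /orP[]/eqP-> ->; rewrite eqxx ?orbT.
by move=> /orP[]/eqP->; rewrite top_notin//= top_dom.
Qed.

(** Z has as many elements as there are colours.  If it carries all of them, only
    the removal of the element coloured i0 leaves the colours other than i0.  If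
    not, either no removal does, or exactly those of the two elements that share a
    colour. *)
Lemma odd_card_typed_facets i0 Z : #|Z| = #|I| ->
  odd #|[set z in Z | g @: (Z :\ z) == [set~ i0]]| = (g @: Z == [set: I]).
Proof.
move=> cZ.
have [/eqP gZ|gZ] := boolP (g @: Z == [set: I]).
  have ginj : {in Z &, injective g}.
    by apply/imset_injP; rewrite gZ cardsT cZ.
  have : i0 \in g @: Z by rewrite gZ inE.
  case/imsetP => z0 z0Z ei0.
  suff -> : [set z in Z | g @: (Z :\ z) == [set~ i0]] = [set z0].
    by rewrite cards1.
  apply/setP => z; rewrite !inE; apply/andP/eqP => [[zZ /eqP e]|->].
    apply/eqP; apply: contraTT isT => zz0.
    have : i0 \in g @: (Z :\ z).
      by rewrite ei0; apply: imset_f; rewrite !inE eq_sym zz0.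
    by rewrite e !inE eqxx.
  split=> //; apply/eqP/setP => i; rewrite !inE; apply/imsetP/idP.
    case=> z'; rewrite !inE => /andP[z'z0 z'Z] ->.
    by apply: contraNneq z'z0 => e; apply/eqP; apply: ginj; rewrite // -ei0 e.
  move=> ii0; have : i \in g @: Z by rewrite gZ inE.
  case/imsetP => z' z'Z e; exists z' => //; rewrite !inE z'Z andbT.
  by apply: contraNneq ii0 => ez; rewrite e ez ei0.
have [->|] := set_0Vmem [set z in Z | g @: (Z :\ z) == [set~ i0]].
  by rewrite cards0.
case=> z0; rewrite inE => /andP[z0Z /eqP gz0].
have cz0 z : z \in Z -> #|Z :\ z| = #|I|.-1.
  by move=> zZ; rewrite -cZ (cardsD1 z Z) zZ.
have ginj z : z \in Z -> g @: (Z :\ z) = [set~ i0] -> {in Z :\ z &, injective g}.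
  by move=> zZ e; apply/imset_injP; rewrite e cardsC1 cz0.
have gz0i : g z0 != i0.
  apply: contraNneq gZ => e; apply/eqP/setP => i; rewrite inE.
  have [->|ii0] := eqVneq i i0; first by rewrite -e imset_f.
  have : i \in g @: (Z :\ z0) by rewrite gz0 !inE.
  by case/imsetP => z; rewrite !inE => /andP[_ zZ] ->; rewrite imset_f.
have : g z0 \in g @: (Z :\ z0) by rewrite gz0 !inE.
case/imsetP => z1; rewrite !inE => /andP[z10 z1Z] e01.
suff -> : [set z in Z | g @: (Z :\ z) == [set~ i0]] = [set z0; z1].
  by rewrite cards2 eq_sym z10.
apply/setP => z; rewrite !inE; apply/idP/idP.
  move=> /andP[zZ /eqP e]; apply: contraTT isT.
  rewrite negb_or => /andP[zz0 zz1].
  have := ginj _ zZ e z0 z1; rewrite !inE z0Z z1Z !(eq_sym _ z) zz0 zz1.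
  by move/(_ isT isT e01) => ez; rewrite ez eqxx in z10.
move=> /orP[]/eqP->; first by rewrite z0Z gz0 eqxx.
rewrite z1Z -gz0 /=; apply/eqP/setP => i; apply/imsetP/imsetP.
  case=> z2; rewrite !inE => /andP[z21 z2Z] ->.
  have [->|z20] := eqVneq z2 z0.
    by exists z1 => //; rewrite !inE z10.
  by exists z2; rewrite // !inE z20.
case=> z2; rewrite !inE => /andP[z20 z2Z] ->.
have [->|z21] := eqVneq z2 z1.
  by exists z0 => //; rewrite !inE z0Z eq_sym z10.
by exists z2; rewrite // !inE z21.
Qed.

(** Count the incidences between doors of colour set [~ i0] and rooms.  By doors
    the number is odd, since Z0 is in one room and the other doors are in two; by
    rooms its parity is that of the number of rainbow rooms. *)
Lemma exists_colorful_room i0 Z0 :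
    #|Z0|.+1 = #|I| -> g @: Z0 = [set~ i0] -> dominated Z0 ->
    #|[set w | (w \notin Z0) && dominated (w |: Z0)]| = 1 ->
    (forall Z, dominated Z -> #|Z|.+1 = #|I| -> g @: Z = [set~ i0] -> Z != Z0 ->
       Z != set0 /\ forall k, exists y, forall l, l != k ->
       exists2 z, z \in Z & key l z < key l y) ->
  exists2 Z, dominated Z & #|Z| = #|I| /\ g @: Z = [set: I].
Proof.
move=> cZ0 gZ0 dZ0 one two.
pose door Z := [&& dominated Z, #|Z|.+1 == #|I| & g @: Z == [set~ i0]].
pose room Z := dominated Z && (#|Z| == #|I|).
pose N := \sum_(Z | door Z) \sum_(Z' | room Z') (Z \subset Z' : nat).
have oddN : odd N.
  have rooms Z : door Z -> \sum_(Z' | room Z') (Z \subset Z' : nat) =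
      #|[set w | (w \notin Z) && dominated (w |: Z)]|.
    case/and3P => dZ /eqP cZ _.
    rewrite -big_mkcondr sum1dep_card /=.
    have inj : {in [set w | (w \notin Z) && dominated (w |: Z)] &,
        injective (fun w => w |: Z)}.
      move=> w w'; rewrite !inE => /andP[wZ _] _ e.
      have : w \in w' |: Z by rewrite -e !inE eqxx.
      by rewrite !inE (negbTE wZ) orbF => /eqP.
    rewrite -(card_in_imset inj); apply: eq_card => Z'; rewrite !inE.
    apply/idP/imsetP.
      case/andP => /andP[dZ' /eqP cZ'] sZ.
      have : #|Z' :\: Z| = 1.
        by rewrite cardsD (setIidPr sZ) cZ' -cZ subSnn.
      move/eqP/cards1P => [w ew].
      have eZ' : Z' = w |: Z.
        rewrite -ew; apply/setP => z; rewrite !inE.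
        by case: (boolP (z \in Z)) => //= [/(subsetP sZ) ->|_]; rewrite ?orbF.
      have : w \in Z' :\: Z by rewrite ew inE.
      by rewrite inE => /andP[wZ _]; exists w; rewrite // inE wZ -eZ'.
    case=> w; rewrite inE => /andP[wZ dw] ->.
    by rewrite /room dw cardsU1 wZ add1n cZ eqxx subsetUr.
  have door0 : door Z0 by rewrite /door dZ0 cZ0 gZ0 !eqxx.
  rewrite /N (bigD1 Z0)//= rooms// one oddD /=.
  rewrite (eq_bigr (fun=> 2)) ?sum_nat_const ?oddM ?andbF//.
  move=> Z /andP[dZ ne]; rewrite rooms//; case/and3P: dZ => dZ /eqP cZ /eqP gZ.
  by have [Zn0 ab] := two _ dZ cZ gZ ne; apply: card_door_rooms.
have : exists2 Z', room Z' & odd (\sum_(Z | door Z) (Z \subset Z' : nat)).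
  apply: contrapT => h; move: oddN; rewrite /N exchange_big /=.
  apply/negP; elim/big_ind : _ => // [m n|Z' rZ'].
    by rewrite oddD; do 2 case: odd.
  by apply/negP => oddZ'; apply: h; exists Z'.
case=> Z /andP[dZ /eqP cZ] oddZ; exists Z => //; split=> //.
apply/eqP; rewrite -(odd_card_typed_facets i0 cZ); move: oddZ.
rewrite -big_mkcondr sum1dep_card /=.
suff -> : #|[set Z1 | door Z1 && (Z1 \subset Z)]| =
    #|[set z in Z | g @: (Z :\ z) == [set~ i0]]| by [].
have inj : {in [set z in Z | g @: (Z :\ z) == [set~ i0]] &,
    injective (fun z => Z :\ z)}.
  move=> z z'; rewrite !inE => /andP[zZ _] _ e.
  have : z \notin Z :\ z' by rewrite -e !inE eqxx.
  by rewrite !inE zZ andbT negbK => /eqP.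
rewrite -(card_in_imset inj); apply: eq_card => Z1; rewrite !inE.
apply/idP/imsetP.
  move=> /andP[/and3P[_ /eqP cZ1 gZ1] sZ1].
  have : #|Z :\: Z1| = 1 by rewrite cardsD (setIidPr sZ1) cZ -cZ1 subSnn.
  move/eqP/cards1P => [z ez].
  have eZ1 : Z1 = Z :\ z.
    rewrite -ez; apply/setP => y; rewrite !inE.
    by case: (boolP (y \in Z1)) => //= [/(subsetP sZ1) ->|]; case: (y \in Z).
  have : z \in Z :\: Z1 by rewrite ez inE.
  by rewrite !inE => /andP[_ zZ]; exists z; rewrite // !inE zZ -eZ1.
case=> z; rewrite !inE => /andP[zZ gz] ->.
rewrite /door gz subD1set (dominatedS _ dZ) ?subD1set//= !andbT.
by rewrite -cZ (cardsD1 z Z) zZ.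
Qed.

End DominatedSets.

Section Scarf.
Import boot.fintype boot.finset.
Variables (T I : finType) (key : I -> T -> nat) (c : T -> I).
Hypothesis key_inj : forall i, injective (key i).
Local Open Scope nat_scope.

(** The faces of the simplex are absorbed into the dominated sets by adding to T
    one slack element for each index i, lowest in the order i, above T in the other
    orders, and coloured i.  A set of elements and slacks then encodes the pair of
    its elements s and of the set C of indices whose slack is missing.  The door
    made of all slacks but one is the boundary door: it lies in a single room. *)
Lemma scarf (t0 : T) : exists (s : {set T}) (C : {set I}),
  (forall y, exists2 i, i \in C & forall x, x \in s -> key i y <= key i x) /\
  (forall i, i \in C -> exists2 x, x \in s & c x = i).
Proof.
pose B := (\max_(i : I) \max_(x : T) key i x).+2.
have key_lt i x : (key i x).+1 < B.
  rewrite /B !ltnS; apply: leq_trans (leq_bigmax_cond _ (erefl : true)).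
  exact: (leq_bigmax_cond (F := key i)).
(* the bound B puts the slack of j above T in every order but j *)
pose key' (i : I) (w : T + I) : nat := match w with
  | inl x => (key i x).+1
  | inr j => if j == i then 0 else B + enum_rank j end.
pose g (w : T + I) : I := match w with inl x => c x | inr i => i end.
have key'_inj i : injective (key' i).
  case=> [x|j] [y|k] /=.
  - by move=> [] /key_inj ->.
  - case: ifP => // _ e; have := key_lt i x.
    by rewrite e ltnNge leq_addr.
  - case: ifP => // _ e; have := key_lt i y.
    by rewrite -e ltnNge leq_addr.
  - case: eqP => [->|ji]; case: eqP => [->|ki] //.
    by move=> /addnI /ord_inj /enum_rank_inj ->.
have domT (Z : {set T + I}) : (exists x, inl x \in Z) ->
    forall k, exists y, forall l, l != k ->
    exists2 z, z \in Z & key' l z < key' l y.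
  move=> [x xZ] k; exists (inr k) => l lk; exists (inl x) => //=.
  by rewrite eq_sym (negbTE lk); apply: ltn_addr; exact: key_lt.
have [i0] : exists i0 : I, True by exists (c t0).
pose Z0 : {set T + I} := [set inr i | i in [set~ i0]].
have inZ0 w : (w \in Z0) = (if w is inr i then i != i0 else false).
  case: w => [x|i]; first by apply/imsetP => -[].
  by rewrite mem_imset ?inE//; move=> ? ? [].
have inr_notin Z (y : T) (i : I) : (forall z, z \in Z -> key' i (inl y) <= key' i z) ->
    inr i \notin Z.
  by move=> h; apply/negP => /h /=; rewrite eqxx.
move=> _; have [] := @exists_colorful_room _ _ key' g key'_inj i0 Z0.
- rewrite card_imset; last by move=> ? ? [].
  by rewrite cardsC1 prednK//; apply/card_gt0P; exists i0.
- by rewrite -imset_comp /= imset_id.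
- apply/dominatedP => -[y|k].
    exists i0 => z; rewrite inZ0; case: z => // k ki0 /=.
    by rewrite (negbTE ki0); apply: leq_trans (leq_addr _ _); apply: ltnW; exact: key_lt.
  by exists k => z _ /=; rewrite eqxx.
- case: (@arg_maxnP _ t0 xpredT (key i0) isT) => m _ max_m.
  have hm y : key i0 y <= key i0 m by exact: max_m.
  apply/eqP/cards1P; exists (inl m); apply/setP => w; rewrite !inE.
  apply/andP/eqP => [[wZ /dominatedP dw]|->].
    have only i y : (forall z, z \in w |: Z0 -> key' i (inl y) <= key' i z) -> i = i0.
      move/inr_notin; rewrite !inE inZ0 negb_or => /andP[_]; rewrite negbK.
      by move/eqP.
    have [i hi] := dw (inl m); have ei := only _ _ hi; subst i.
    case: w wZ dw hi {only} => [x|k] wZ dw hi.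
      congr inl; apply: (@key_inj i0); apply/eqP.
      by rewrite eqn_leq hm// -ltnS; have := hi (inl x); rewrite !inE eqxx; apply.
    move: wZ; rewrite inZ0 negbK => /eqP ek.
    by have := hi (inr k); rewrite !inE /= ek !eqxx => /(_ isT).
  split; first by rewrite inZ0.
  apply/dominatedP => -[y|k]; last by exists k => z _ /=; rewrite eqxx.
  exists i0 => z; rewrite !inE => /orP[/eqP->/=|]; first exact: hm.
  rewrite inZ0; case: z => // k ki0 /=.
  by rewrite (negbTE ki0); apply: leq_trans (leq_addr _ _); apply: ltnW; exact: key_lt.
- move=> Z dZ cZ gZ ne.
  have [x xZ] : exists x, inl x \in Z.
    apply: contrapT => h.
    have sZ : Z \subset Z0.
      apply/subsetP => -[x xZ|i iZ]; first by case: h; exists x.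
      rewrite inZ0.
      have : g (inr i) \in g @: Z by exact: imset_f.
      by rewrite gZ !inE.
    case/eqP: ne; apply/eqP; rewrite eqEcard sZ /= card_imset; last by move=> ? ? [].
    by rewrite cardsC1 -cZ.
  by split; [apply/set0Pn; exists (inl x)|apply: domT; exists x].
- move=> Z /dominatedP dZ [cZ gZ].
  exists [set x | inl x \in Z], [set i | inr i \notin Z]; split.
    move=> y; have [i hi] := dZ (inl y); exists i; first by rewrite inE; exact: inr_notin hi.
    by move=> x; rewrite inE => /hi.
  move=> i; rewrite inE => iZ.
  have : i \in g @: Z by rewrite gZ inE.
  case/imsetP => -[x|j] zZ /= e; first by exists x; rewrite ?inE.
  by rewrite e zZ in iZ.
Qed.

End Scarf.

(** * Colourings of the integer points of a simplex *)

Section Grid.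
Import boot.fintype boot.finset.
Local Open Scope nat_scope.

(** For the lattice points of the dilated simplex ordered by coordinates, a
    dominated set is small and close to the face C: if the minima over s of the
    coordinates in C had sum at most N - #|C|, they could all be raised by one
    within the simplex, against domination. *)
Lemma colorful_grid_cell n N (c : {ffun 'I_n.+1 -> 'I_N.+1} -> 'I_n.+1) :
  exists (C : {set 'I_n.+1}) (k : 'I_n.+1)
         (p : 'I_n.+1 -> {ffun 'I_n.+1 -> 'I_N.+1}),
  [/\ k \in C, forall i, i \in C -> c (p i) = i,
      forall i, \sum_j p i j = N,
      forall i i' j, p i j <= p i' j + n.+1 &
      forall i j, j \notin C -> p i j <= n.+1].
Proof.
pose T := Finite.clone {f : {ffun 'I_n.+1 -> 'I_N.+1} | \sum_j f j == N} _.
have mkT (a : 'I_n.+1 -> nat) : \sum_j a j = N ->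
    exists t : T, forall j, sval t j = a j :> nat.
  move=> sa.
  have aN j : a j < N.+1 by rewrite ltnS -sa (bigD1 j)//= leq_addr.
  pose f : {ffun 'I_n.+1 -> 'I_N.+1} := [ffun j => inord (a j)].
  have sf : \sum_j f j == N.
    by rewrite -[X in _ == X]sa; apply/eqP/eq_bigr => j _; rewrite ffunE inordK.
  by exists (exist _ f sf) => j; rewrite ffunE inordK.
(* ties between equal coordinates are broken by the rank *)
pose key (i : 'I_n.+1) (t : T) := sval t i * #|T| + enum_rank t.
have key_lt i (t t' : T) : sval t i < sval t' i -> key i t < key i t'.
  move=> lt; apply: (@leq_trans ((sval t i).+1 * #|T|)).
    by rewrite /key mulSn addnC ltn_add2r ltn_ord.
  by apply: leq_trans (leq_addr _ _); rewrite leq_mul2r lt orbT.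
have key_inj i : injective (key i).
  move=> t t' e.
  have et : sval t i = sval t' i :> nat.
    have [/key_lt|/key_lt|//] := ltngtP (sval t i) (sval t' i);
    by rewrite e ltnn.
  by move: e; rewrite /key et => /addnI /ord_inj /enum_rank_inj.
have [t0 _] : exists t : T, forall j, sval t j = (if j == ord0 then N else 0) :> nat.
  by apply: mkT; rewrite -big_mkcond big_pred1_eq.
have [s [C [dom col]]] := scarf (c \o sval) key_inj t0.
have [k kC _] := dom t0.
have [xk xks _] := col k kC.
have [mt mtP] : {mt : 'I_n.+1 -> T & forall i, mt i \in s /\
    forall x, x \in s -> sval (mt i) i <= sval x i}.
  apply: (@choice _ _ (fun i (t : T) => t \in s /\
    forall x, x \in s -> sval t i <= sval x i)) => i.
  case: (@arg_minnP _ xk (mem s) (fun x : T => sval x i : nat) xks) => x xs hx.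
  by exists x.
pose m (i : 'I_n.+1) : nat := sval (mt i) i.
have m_le i x : x \in s -> m i <= sval x i by exact: (mtP i).2.
have m_ex i : exists2 x, x \in s & m i = sval x i :> nat.
  by exists (mt i) => //; exact: (mtP i).1.
have sum_m : N < \sum_(i in C) m i + #|C|.
  rewrite ltnNge; apply/negP => le.
  have [y hy] : exists y : T, forall j, sval y j =
      (if j \in C then (m j).+1 else 0) +
      (if j == k then N - (\sum_(i in C) m i + #|C|) else 0) :> nat.
    apply: mkT; rewrite big_split/= -!big_mkcond big_pred1_eq.
    under eq_bigr do rewrite -addn1.
    by rewrite big_split/= sum1_card subnKC.
  have [i iC hi] := dom y; have [x xs ex] := m_ex i.
  have := hi x xs; rewrite leqNgt => /negP; apply; apply: key_lt.
  by rewrite hy iC -ex addSn ltnS leq_addr.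
have cardC : #|C| <= n.+1 by rewrite -[X in _ <= X]card_ord max_card.
have sumT (x : T) : \sum_j sval x j = N by apply/eqP; exact: (svalP x).
have sumC (x : T) : x \in s -> N < \sum_(i in C) sval x i + #|C|.
  move=> xs; apply: leq_trans sum_m _; rewrite leq_add2r.
  by apply: leq_sum => i _; exact: m_le.
have near_m (x : T) j : x \in s -> j \in C -> sval x j <= m j + n.+1.
  move=> xs jC; have := sum_m.
  rewrite (bigD1 j)//= => lt.
  have := sumT x; rewrite (bigID (mem C))/= => e.
  have : \sum_(i in C) sval x i <= N.
    by apply: leq_trans (leq_addr _ _) (eq_leq e).
  rewrite (bigD1 j)//=.
  have : \sum_(i in C | i != j) m i <= \sum_(i in C | i != j) sval x i.
    by apply: leq_sum => i _; exact: m_le.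
  move: lt cardC; move: (\sum_(i in C | i != j) m i) => a.
  move: (\sum_(i in C | i != j) _) => b; move: #|C| (m j) (nat_of_ord _) => q u v.
  by clear; lia.
have small (x : T) j : x \in s -> j \notin C -> sval x j <= n.+1.
  move=> xs jC; have := sumC x xs; have := sumT x.
  rewrite (bigID (mem C))/= (bigD1 (P := fun i => i \notin C) j)//=.
  move: cardC; move: (\sum_(i in C) _) (\sum_(i | (i \notin C) && _) _) => a b.
  by move: #|C| (nat_of_ord _) => q u; clear; lia.
have [p hp] : {p : 'I_n.+1 -> T & forall i, p i \in s /\
    (i \in C -> c (sval (p i)) = i)}.
  apply: (@choice _ _ (fun i (x : T) => x \in s /\ (i \in C -> c (sval x) = i))) => i.
  have [iC|iC] := boolP (i \in C); last by exists xk.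
  by have [x xs cx] := col i iC; exists x.
exists C, k, (fun i => sval (p i)); split => //.
- by move=> i iC; exact: (hp i).2.
- move=> i i' j; have [jC|jC] := boolP (j \in C).
    apply: leq_trans (near_m _ _ (hp i).1 jC) _.
    by rewrite leq_add2r m_le//; exact: (hp i').1.
  by apply: leq_trans (small _ _ (hp i).1 jC) (leq_addl _ _).
- by move=> i j jC; apply: small => //; exact: (hp i).1.
Qed.

End Grid.

Local Open Scope classical_set_scope.
Local Open Scope ring_scope.

(** * Convex sets and convex hulls *)

Section Convex.
Context {R : realType} {E : normedModType R}.
Implicit Types (A B K : set E) (x y z : E) (r s : R).

Definition cvx A := forall x y s, A x -> A y -> 0 <= s -> s <= 1 ->
  A (s *: x + (1 - s) *: y).

(** The inductive form makes hull arguments inductions over two-point mixtures. *)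
Inductive hull A : E -> Prop :=
| hull_in x : A x -> hull A x
| hull_mix x y s : hull A x -> hull A y -> 0 <= s -> s <= 1 ->
    hull A (s *: x + (1 - s) *: y).

Lemma hull_cvx A : cvx (hull A).
Proof. by move=> x y s hx hy s0 s1; exact: hull_mix. Qed.

Lemma hull_min A B : cvx B -> A `<=` B -> hull A `<=` B.
Proof.
move=> cB AB x; elim=> [{}x /AB//|{}x y s _ Bx _ By s0 s1]; exact: cB.
Qed.

Lemma hullS A B : A `<=` B -> hull A `<=` hull B.
Proof.
by move=> AB; apply: hull_min; [exact: hull_cvx|move=> x /AB; exact: hull_in].
Qed.

Lemma cvx_norm_mix x y s : 0 <= s -> s <= 1 ->
  `|s *: x + (1 - s) *: y| <= s * `|x| + (1 - s) * `|y|.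
Proof.
move=> s0 s1; apply: le_trans (ler_normD _ _) _.
by rewrite !normrZ ger0_norm// ger0_norm// subr_ge0.
Qed.

Lemma mix_subr x y z s :
  s *: x + (1 - s) *: y - z = s *: (x - z) + (1 - s) *: (y - z).
Proof.
by rewrite !scalerBr addrACA -opprD -scalerDl addrCA subrr addr0 scale1r.
Qed.

Lemma cvx_ball z r : cvx [set x | `|x - z| <= r].
Proof.
move=> x y s /= hx hy s0 s1.
rewrite mix_subr; apply: le_trans (cvx_norm_mix _ _ s0 s1) _.
apply: (@le_trans _ _ (s * r + (1 - s) * r)); last by rewrite -mulrDl subrKC mul1r.
by rewrite lerD// ler_wpM2l// subr_ge0.
Qed.

Lemma cvx_sum K (I : finType) (a : I -> R) (e : I -> E) :
  cvx K -> (forall i, 0 <= a i) -> (forall i, K (e i)) -> \sum_i a i = 1 ->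
  K (\sum_i a i *: e i).
Proof.
move=> cK a0 Ke a1.
have key (s : seq I) : 0 < \sum_(i <- s) a i ->
    K ((\sum_(i <- s) a i)^-1 *: \sum_(i <- s) a i *: e i).
  elim: s => [|i s IH]; first by rewrite big_nil ltxx.
  rewrite !big_cons; set S := \sum_(j <- s) a j; set V := \sum_(j <- s) _.
  have S0 : 0 <= S by exact: sumr_ge0.
  have [S_gt0|S_le0] := ltP 0 S; last first.
    have eS : S = 0 by apply/eqP; rewrite eq_le S0 S_le0.
    have aj j : j \in s -> a j = 0.
      move=> js; apply/eqP; rewrite eq_le a0 andbT -eS /S.
      by rewrite (big_rem j)//= lerDl sumr_ge0.
    have -> : V = 0.
      rewrite /V big_seq_cond big1// => j; rewrite andbT => /aj ->.
      by rewrite scale0r.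
    by rewrite eS !addr0 => ai0; rewrite scalerA mulVf ?gt_eqF// scale1r.
  move=> D0; set D := a i + S in D0 *.
  have -> : D^-1 *: (a i *: e i + V) =
      (a i / D) *: e i + (1 - a i / D) *: (S^-1 *: V).
    have -> : 1 - a i / D = S / D.
      by rewrite -[1](@divff _ D) ?gt_eqF// -mulrBl /D addrAC subrr add0r.
    rewrite scalerDr !scalerA mulrC; congr (_ + _ *: _).
    by rewrite mulrAC divff ?gt_eqF// mul1r.
  apply: cK => //; first exact: IH.
  - by rewrite divr_ge0// ltW.
  - by rewrite ler_pdivrMr// mul1r lerDl.
by have := key (index_enum I); rewrite a1 invr1 scale1r; apply.
Qed.

End Convex.

(** * Approximate fixed points on totally bounded convex sets *)

Section ApproximateFixedPoint.
Context {R : realType} {E : normedModType R}.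

(** On a fine grid of the simplex spanned by the net, colour a point with a net
    point close to its image.  In a rainbow cell a point X has almost all its weight
    on the net points of the colours C, and each of these is close to the image of a
    point of the cell itself; replacing net points by these images moves X only
    slightly. *)
Lemma approximate_fixed_point (K : set E) (G : E -> E) n (e : 'I_n.+1 -> E)
    (eps : R) : 0 < eps -> cvx K -> (forall i, K (e i)) ->
    (forall x, K x -> K (G x)) ->
    (forall x, K x -> exists i, `|x - e i| <= eps) ->
  exists2 x, K x &
    exists2 y, hull (G @` [set x' | K x' /\ `|x' - x| <= eps]) y &
    `|x - y| <= 2 * eps.
Proof.
move=> eps0 cK Ke KG net.
pose M := \sum_i `|e i|.
have M0 : 0 <= M by apply: sumr_ge0.
have eM i : `|e i| <= M by rewrite /M (bigD1 i)//= lerDl sumr_ge0.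
pose m : R := n.+1%:R.
have m1 : 1 <= m by rewrite /m ler1n.
(* one error is the size of a cell, the other the weight outside its colours *)
have [N NE] : exists N : nat, m * m * (2 * M + eps) / eps <= N.+1%:R.
  have [N hN] : exists N : nat, m * m * (2 * M + eps) / eps <= N%:R.
    exists (Num.trunc (m * m * (2 * M + eps) / eps)).+1.
    by apply/ltW/truncnS_gt.
  by exists N; apply: le_trans hN _; rewrite ler_nat.
pose L : R := N.+1%:R.
have L0 : 0 < L by rewrite ltr0n.
have mesh : m * m / L * (2 * M + eps) <= eps.
  move: NE; rewrite ler_pdivrMr// => h.
  by rewrite mulrAC ler_pdivrMr// [leRHS]mulrC.
have mesh1 : m / L * M <= eps.
  apply: le_trans mesh; rewrite !(mulrAC _ L^-1) ler_pM2r ?invr_gt0//.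
  rewrite -mulrA; apply: ler_wpM2l; first exact: le_trans ler01 m1.
  by rewrite (@le_trans _ _ (2 * M + eps)) ?ler_peMl//; lra.
pose S (f : {ffun 'I_n.+1 -> 'I_N.+2}) : E := \sum_j ((f j : nat)%:R / L) *: e j.
have weights (f : {ffun 'I_n.+1 -> 'I_N.+2}) : (\sum_j f j)%N = N.+1 ->
    \sum_j (f j : nat)%:R / L = 1.
  by move=> sf; rewrite -mulr_suml -natr_sum sf divff ?gt_eqF.
have KS (f : {ffun 'I_n.+1 -> 'I_N.+2}) : (\sum_j f j)%N = N.+1 -> K (S f).
  by move=> sf; apply: cvx_sum => //; [move=> i; rewrite divr_ge0|exact: weights].
have [c hc] : {c : {ffun 'I_n.+1 -> 'I_N.+2} -> 'I_n.+1 &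
    forall f, K (S f) -> `|G (S f) - e (c f)| <= eps}.
  apply: (@choice _ _ (fun f i => K (S f) -> `|G (S f) - e i| <= eps)) => f.
  case: (pselect (K (S f))) => [/KG/net[i hi]|nK]; first by exists i.
  by exists ord0.
have [C [k [p [kC pC sump nearp offC]]]] := colorful_grid_cell c.
exists (S (p k)); first exact: KS.
exists (\sum_j ((p k j : nat)%:R / L) *: G (S (p j))).
  apply: cvx_sum => //.
  - exact: hull_cvx.
  - by move=> i; rewrite divr_ge0.
  - move=> i; apply: hull_in; exists (S (p i)) => //; split; first exact: KS.
    rewrite /S -sumrB; apply: le_trans (ler_norm_sum _ _ _) _.
    apply: le_trans mesh1; rewrite /M mulr_sumr; apply: ler_sum => j _.
    rewrite -scalerBl normrZ ler_wpM2r//.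
    rewrite -mulrBl normrM [ `|L^-1|]gtr0_norm ?invr_gt0//.
    rewrite ler_pM2r ?invr_gt0//.
    have := nearp i k j; have := nearp k i j.
    rewrite -!(ler_nat R) !natrD -/m => h1 h2.
    by rewrite ler_norml; apply/andP; split; lra.
  - exact: weights.
rewrite /S -sumrB; apply: le_trans (ler_norm_sum _ _ _) _.
have bnd (j : 'I_n.+1) : `|((p k j : nat)%:R / L) *: e j - ((p k j : nat)%:R / L) *: G (S (p j))|
    <= (p k j : nat)%:R / L * eps + m / L * (2 * M + eps).
  have a0 : 0 <= (p k j : nat)%:R / L by rewrite divr_ge0.
  have mL0 : 0 <= m / L by rewrite divr_ge0.
  have Me0 : 0 <= 2 * M + eps by lra.
  rewrite -scalerBr normrZ ger0_norm//.
  case: (boolP (j \in C)) => jC.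
    rewrite -[leLHS]addr0; apply: lerD; last exact: mulr_ge0.
    apply: ler_wpM2l => //.
    by rewrite distrC -{2}(pC j jC); apply/hc/KS.
  rewrite -[leLHS]add0r; apply: lerD; first by rewrite mulr_ge0// ltW.
  apply: ler_pM => //.
    by rewrite ler_pM2r ?invr_gt0// ler_nat offC.
  have [i hi] := net _ (KG _ (KS _ (sump j))).
  have -> : e j - G (S (p j)) = e j - e i - (G (S (p j)) - e i).
    by rewrite opprB addrA subrK.
  apply: le_trans (ler_normB _ _) _; apply: lerD => //.
  apply: le_trans (ler_normB _ _) _.
  by have := eM j; have := eM i; lra.
apply: le_trans (ler_sum _ (fun j _ => bnd j)) _.
rewrite big_split/= -mulr_suml weights// mul1r sumr_const card_ord.
rewrite -[X in _ + X]mulr_natl -/m (_ : 2 * eps = eps + eps); last by lra.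
by rewrite lerD2l !mulrA.
Qed.

End ApproximateFixedPoint.

(** * Weakly convergent subsequences by hulls of tails *)

Section Subsequences.

Lemma increasing_ge (s : nat -> nat) : {homo s : i j / (i < j)%N} ->
  forall k, (k <= s k)%N.
Proof.
by move=> hs; elim=> // k IH; apply: leq_ltn_trans IH _; apply: hs.
Qed.

Lemma increasing_reflect (s : nat -> nat) : {homo s : i j / (i < j)%N} ->
  forall i j, (s i <= s j)%N -> (i <= j)%N.
Proof. by move=> hs i j; apply: contraTT; rewrite -!ltnNge; exact: hs. Qed.

Lemma exists_subsequence (P : nat -> nat -> Prop) :
  (forall i n, exists2 k, (n <= k)%N & P i k) ->
  exists2 s : nat -> nat, {homo s : i j / (i < j)%N} & forall i, P i (s i).
Proof.
move=> h; have [f hf] : {f : nat * nat -> nat & forall p,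
    (p.2 <= f p)%N /\ P p.1 (f p)}.
  apply: (@choice _ _ (fun p k => (p.2 <= k)%N /\ P p.1 k)) => -[i n].
  by have [k nk Pk] := h i n; exists k.
pose s := fix s i := if i is j.+1 then f (i, (s j).+1) else f (0%N, 0%N).
exists s; last first.
  by case=> [|i]; [exact: (hf (0%N, 0%N)).2|exact: (hf (i.+1, (s i).+1)).2].
by apply: (homo_ltn ltn_trans) => i; exact: (hf (i.+1, (s i).+1)).1.
Qed.

End Subsequences.

Section TailHull.
Context {R : realType} {E : normedModType R}.
Variable x : nat -> E.
Implicit Types (S T : set nat) (c : R).

Definition unbounded S := forall n, exists2 k, (n <= k)%N & S k.

Definition tail_hull S n : E -> Prop := hull (x @` [set k | S k /\ (n <= k)%N]).

(** The supremum of these c is the limit, as n grows, of the least norm of the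
    points of the hull of the n-th tail. *)
Definition tail_norm_ge S c := exists n, forall y, tail_hull S n y -> c <= `|y|.

Lemma tail_hullS S T m n :
  (forall k, S k -> (n <= k)%N -> T k /\ (m <= k)%N) ->
  tail_hull S n `<=` tail_hull T m.
Proof.
by move=> h; apply: hullS => _ [k [Sk nk] <-]; exists k => //; exact: h.
Qed.

Lemma tail_norm_geS S T n c : (forall k, S k -> (n <= k)%N -> T k) ->
  tail_norm_ge T c -> tail_norm_ge S c.
Proof.
move=> h [m hm]; exists (maxn m n) => y hy; apply: hm; apply: tail_hullS hy => k Sk.
by rewrite geq_max => /andP[mk nk]; split=> //; exact: h.
Qed.

Lemma tail_norm_ge_le S c c' : c' <= c -> tail_norm_ge S c -> tail_norm_ge S c'.
Proof. by move=> cc' [n hn]; exists n => y /hn; exact: le_trans. Qed.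

Lemma tail_norm_ge0 S : tail_norm_ge S 0.
Proof. by exists 0%N. Qed.

Lemma tail_norm_ge_bound S c M : (forall k, `|x k| <= M) -> unbounded S ->
  tail_norm_ge S c -> c <= M.
Proof.
move=> xM uS [n hn]; have [k nk Sk] := uS n; apply: le_trans (xM k).
by apply: hn; apply: hull_in; exists k.
Qed.

(** Diagonal extraction: the n-th set nearly maximizes, among the subsequences of
    the previous one, the limit of the minimal norms of the hulls of tails.  That
    limit depends on tails only and increases along subsequences, so for the
    diagonal sequence no further extraction can raise it. *)
Lemma exists_tail_extremal_subsequence M : (forall k, `|x k| <= M) ->
  exists2 d : nat -> nat, {homo d : i j / (i < j)%N} &
    forall T c c', T `<=` range d -> unbounded T -> c' < c ->
      tail_norm_ge T c -> tail_norm_ge (range d) c'.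
Proof.
move=> xM.
have [step stepP] : {step : nat * set nat -> set nat &
    forall p, unbounded p.2 -> [/\ step p `<=` p.2, unbounded (step p) &
      forall T c, T `<=` p.2 -> unbounded T -> tail_norm_ge T c ->
        tail_norm_ge (step p) (c - p.1.+1%:R^-1)]}.
  apply: (@choice _ _ (fun (p : nat * set nat) (S' : set nat) => unbounded p.2 ->
      [/\ S' `<=` p.2, unbounded S' &
      forall T c, T `<=` p.2 -> unbounded T -> tail_norm_ge T c ->
        tail_norm_ge S' (c - p.1.+1%:R^-1)])) => -[i S] /=.
  have [uS|nuS] := pselect (unbounded S); last by exists S.
  pose A := [set c | exists T, [/\ T `<=` S, unbounded T & tail_norm_ge T c]].
  have supA : has_sup A.
    split; first by exists 0, S; split => //; exact: tail_norm_ge0.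
    by exists M => c [T [_ uT /(tail_norm_ge_bound xM uT)]].
  have i0 : 0 < (i.+1%:R^-1 : R) by rewrite invr_gt0.
  have [c0 [S' [S'S uS' hS']] ltc0] := sup_adherent i0 supA.
  exists S' => _; split => // T c TS uT hT; apply: tail_norm_ge_le hS'.
  apply: le_trans (ltW ltc0); rewrite lerD2r; apply: ub_le_sup.
    by case: supA.
  by exists T.
pose Sq := fix Sq n := if n is k.+1 then step (k, Sq k) else setT.
have uSq n : unbounded (Sq n).
  elim: n => [k|n IH]; first by exists k.
  by have [] := stepP (n, Sq n) IH.
have SqS n k : Sq (n + k)%N `<=` Sq n.
  elim: k => [|k IH]; first by rewrite addn0.
  rewrite addnS; apply: subset_trans IH.
  by have [] := stepP ((n + k)%N, Sq (n + k)%N) (uSq _).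
have [nxt nxtP] : {nxt : nat * nat -> nat & forall p,
    (p.2 <= nxt p)%N /\ Sq p.1 (nxt p)}.
  apply: (@choice _ _ (fun (p : nat * nat) k => (p.2 <= k)%N /\ Sq p.1 k)) => -[i n].
  by have [k nk Sk] := uSq i n; exists k.
pose d := fix d k := if k is j.+1 then nxt (j.+1, (d j).+1) else nxt (0%N, 0%N).
have hd : {homo d : i j / (i < j)%N}.
  apply: (homo_ltn ltn_trans) => i; exact: (nxtP (i.+1, (d i).+1)).1.
have dSq i : Sq i (d i).
  by case: i => [|i]; [exact: (nxtP (0%N, 0%N)).2|exact: (nxtP (i.+1, (d i).+1)).2].
have eventually_Sq i k : range d k -> (d i <= k)%N -> Sq i k.
  move=> [j _ <-] /(increasing_reflect hd) ij.
  by apply: (SqS i (j - i)%N); rewrite subnKC.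
exists d => // T c c' Td uT c'c hT.
have [i hi] : exists i : nat, (i.+1%:R^-1 : R) <= c - c'.
  have cc0 : 0 < c - c' by rewrite subr_gt0.
  exists (Num.trunc (c - c')^-1).
  rewrite -[leRHS]invrK lef_pV2 ?posrE ?invr_gt0//.
  exact/ltW/truncnS_gt.
pose T' := [set k | T k /\ (d i <= k)%N].
have T'Sq : T' `<=` Sq i by move=> k [/Td Tk dk]; exact: eventually_Sq.
have uT' : unbounded T'.
  move=> n; have [k] := uT (maxn n (d i)); rewrite geq_max => /andP[nk dk] Tk.
  by exists k.
have hT' : tail_norm_ge T' c by apply: (tail_norm_geS (n := 0%N) _ hT) => k [].
have [_ _ /(_ _ _ T'Sq uT' hT') low] := stepP (i, Sq i) (uSq i).
apply: tail_norm_ge_le (tail_norm_geS (eventually_Sq i.+1) low).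
by rewrite /= lerBrDr addrC -lerBrDr.
Qed.

End TailHull.

Section UniformConvexity.
Context {R : realType} {E : normedModType R}.

(** One modulus serves all balls of radius at most M. *)
Lemma uniformly_convex_scaled M eps : uniformly_convex E -> 0 < eps ->
  exists2 rho : R, 0 < rho & forall r (a b : E), r <= M -> `|a| <= r -> `|b| <= r ->
    eps <= `|a - b| -> `|2^-1 *: (a + b)| <= r * (1 - rho).
Proof.
move=> uc eps0; have [M0|M0] := ltP 0 M; last first.
  exists 1 => // r a b rM ar br; have := ler_normB a b.
  by move=> h1 h2; exfalso; lra.
have [rho rho0 hrho] := uc (eps / M) (divr_gt0 eps0 M0).
exists rho => // r a b rM ar br ab.
have r0 : 0 < r by have := ler_normB a b; lra.
have sc (z : E) : `|z| <= r -> `|r^-1 *: z| <= 1.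
  by move=> zr; rewrite normrZ gtr0_norm ?invr_gt0// mulrC ler_pdivrMr// mul1r.
have := hrho _ _ (sc _ ar) (sc _ br).
rewrite -scalerBr -scalerDr normrZ gtr0_norm ?invr_gt0//.
have -> : 2^-1 *: (r^-1 *: (a + b)) = r^-1 *: (2^-1 *: (a + b)).
  by rewrite !scalerA mulrC.
rewrite [ `|r^-1 *: _|]normrZ [ `|r^-1|]gtr0_norm ?invr_gt0//.
rewrite ler_pdivrMl// => h; apply: h.
rewrite ler_pdivrMr// -mulrA ler_pdivlMl// [leLHS]mulrC.
by apply: ler_pM => //; exact: ltW.
Qed.

End UniformConvexity.

Section HullConvergence.
Context {R : realType} {E : normedModType R}.
Implicit Types (v : nat -> E) (l : E).

(** A substitute for weak convergence with Mazur's theorem built in; it is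
    equivalent to it by Hahn-Banach separation. *)
Definition hull_cvg v l := forall s : nat -> nat, {homo s : i j / (i < j)%N} ->
  forall eps : R, 0 < eps -> exists2 y, hull (range (v \o s)) y & `|y - l| <= eps.

Lemma hull_cvg_subsequence v l s : {homo s : i j / (i < j)%N} ->
  hull_cvg v l -> hull_cvg (v \o s) l.
Proof.
move=> hs hv t ht; apply: (hv (s \o t)) => i j ij /=; exact/hs/ht.
Qed.

Lemma hull_cvg_closed_cvx (C : set E) v l : closed C -> cvx C ->
  (forall j, C (v j)) -> hull_cvg v l -> C l.
Proof.
move=> clC cC Cv hv; rewrite (closure_id C).1// => B /nbhs_normP[eps /= eps0 hB].
have eps20 : 0 < eps / 2 by rewrite divr_gt0.
have [y hy yl] := hv id (fun _ _ => id) _ eps20.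
exists y; split; first by apply: hull_min hy => // _ [k _ <-]; exact: Cv.
by apply: hB => /=; rewrite distrC; apply: le_lt_trans yl _; lra.
Qed.

(** If a functional stayed above its limit value by eps infinitely often, it would
    do so on the whole hull of a subsequence, hence near l. *)
Lemma hull_cvg_weakly v l : hull_cvg v l -> weakly_converges v l.
Proof.
move=> hv.
suff below (f : E -> R^o) (eps : R) :
    (forall a b r, f (r *: a + (1 - r) *: b) = r * f a + (1 - r) * f b) ->
    continuous f -> 0 < eps -> \forall n \near \oo, f (v n) < f l + eps.
  move=> phi cphi; apply/cvgrPdist_lt => eps eps0.
  have aff (a b : E) (r : R) :
      phi (r *: a + (1 - r) *: b) = r * phi a + (1 - r) * phi b.
    by rewrite linearD !linearZ.
  near=> n.
  have h1 : phi (v n) < phi l + eps by near: n; exact: below.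
  have h2 : - phi (v n) < - phi l + eps.
    near: n; apply: (below (fun z => - phi z)) => // [a b r|z].
      by rewrite aff opprD !mulrN.
    by apply: cvgN; exact: cphi.
  by rewrite ltr_norml; apply/andP; split; lra.
move=> aff cphi eps0; apply: contrapT => nev.
have [s hs sP] : exists2 s : nat -> nat, {homo s : i j / (i < j)%N} &
    forall k, f l + eps <= f (v (s k)).
  apply: (@exists_subsequence (fun _ k => f l + eps <= f (v k))) => _ n.
  apply: contrapT => nk; apply: nev.
  exists n => // k /= nk'; rewrite ltNge; apply/negP => h; apply: nk.
  by exists k.
have /cvgrPdist_lt/(_ _ eps0)/nbhs_normP[del /= del0 hdel] := cphi l.
have del20 : 0 < del / 2 by rewrite divr_gt0.
have [y hy yl] := hv s hs _ del20.
have : f l + eps <= f y.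
  have := hull_min (B := [set y | f l + eps <= f y]) _ _ hy; apply.
    move=> a b r /= ha hb r0 r1; rewrite aff.
    have := ler_wpM2l r0 ha.
    have : 0 <= 1 - r by rewrite subr_ge0.
    move=> /(ler_wpM2l)/(_ _ _ hb); lra.
  by move=> _ [k _ <-]; exact: sP.
have /= : `|f l - f y| < eps.
  by apply: hdel => /=; rewrite distrC; apply: le_lt_trans yl _; lra.
rewrite ltr_norml => /andP[h1 h2] h3; lra.
Unshelve. all: by end_near. Qed.

End HullConvergence.

Section WeakCompactness.
Context {R : realType} {E : completeNormedModType R}.

(** Let m be the limit of the minimal norms of the hulls of the tails of an
    extremal subsequence.  The midpoint of two points of a tail hull is in that
    hull, hence of norm almost m; by uniform convexity two points of norm almost m
    are then close.  So nearly minimal points converge, to some l.  By extremality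
    the hull of any further subsequence also has points of norm almost m, and these
    are close to l as well. *)
Lemma bounded_hull_cvg_subsequence (x : nat -> E) M : uniformly_convex E ->
  (forall k, `|x k| <= M) ->
  exists2 d : nat -> nat, {homo d : i j / (i < j)%N} &
    exists l, hull_cvg (x \o d) l.
Proof.
move=> uc xM; have [d hd ext] := exists_tail_extremal_subsequence xM.
exists d => //; set D := range d in ext.
have uD : unbounded D.
  by move=> n; exists (d n); [exact: increasing_ge|exists n].
pose A := [set c | tail_norm_ge x D c].
have supA : has_sup A.
  split; first by exists 0; exact: tail_norm_ge0.
  by exists M => c; exact: tail_norm_ge_bound.
pose m := sup A.
have below c : c < m -> tail_norm_ge x D c.
  move=> cm; have cm0 : 0 < m - c by rewrite subr_gt0.
  have [c' Ac' lt] := sup_adherent cm0 supA.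
  by apply: tail_norm_ge_le Ac'; move: lt; rewrite opprB addrCA subrr addr0 => /ltW.
have above T c n : T `<=` D -> unbounded T -> m < c ->
    exists2 y, tail_hull x T n y & `|y| < c.
  move=> TD uT mc; apply: contrapT => no.
  have hT : tail_norm_ge x T c.
    exists n => y hy; rewrite leNgt; apply/negP => yc; apply: no.
    by exists y.
  have : tail_norm_ge x D ((m + c) / 2) by apply: (ext _ _ _ TD uT _ hT); lra.
  move=> h; have : (m + c) / 2 <= m by apply: ub_le_sup; first by case: supA.
  lra.
have near_min eps : 0 < eps -> exists2 del : R, 0 < del & exists n, forall y y',
    tail_hull x D n y -> tail_hull x D n y' -> `|y| <= m + del ->
    `|y'| <= m + del -> `|y - y'| < eps.
  move=> eps0; have [rho rho0 hrho] := uniformly_convex_scaled (m + 1) uc eps0.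
  pose del := Num.min 1 (rho * eps / 8).
  have re0 : 0 < rho * eps by exact: mulr_gt0.
  have del0 : 0 < del by rewrite lt_min ltr01; lra.
  have del1 : del <= 1 by rewrite ge_min lexx.
  have delr : del <= rho * eps / 8 by rewrite ge_min lexx orbT.
  have [n hn] : tail_norm_ge x D (m - del) by apply: below; lra.
  exists del => //; exists n => y y' hy hy' ym y'm; rewrite ltNge; apply/negP => yy'.
  have le1 : m + del <= m + 1 by rewrite lerD2l.
  have := hrho _ _ _ le1 ym y'm yy'.
  have : m - del <= `|2^-1 *: (y + y')|.
    apply: hn; rewrite scalerDr.
    have -> : 2^-1 *: y' = (1 - 2^-1 : R) *: y' by congr (_ *: _); lra.
    by apply: hull_mix => //; lra.
  have := ler_normB y y'.
  by nra.
have [y hy] : {y : nat -> E & forall k, tail_hull x D k (y k) /\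
    `|y k| < m + k.+1%:R^-1}.
  apply: (@choice _ _ (fun k z => tail_hull x D k z /\ `|z| < m + k.+1%:R^-1)) => k.
  have mk : m < m + k.+1%:R^-1 by rewrite ltrDl invr_gt0.
  by have [z h1 h2] := above D _ k (@subset_refl _ _) uD mk; exists z.
have y_near eps : 0 < eps -> exists2 del, 0 < del & exists n, forall k z,
    (n <= k)%N -> tail_hull x D n z -> `|z| <= m + del -> `|y k - z| < eps.
  move=> /near_min[del del0 [n hn]]; exists del => //.
  have [N hN] : exists N : nat, (N.+1%:R^-1 : R) <= del.
    exists (Num.trunc del^-1).
    rewrite -[leRHS]invrK lef_pV2 ?posrE ?invr_gt0//.
    exact/ltW/truncnS_gt.
  exists (maxn n N) => k z; rewrite geq_max => /andP[nk Nk] hz zm; apply: hn => //.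
  - by apply: tail_hullS (hy k).1 => j Dj kj; split=> //; exact: leq_trans kj.
  - by apply: tail_hullS hz => j Dj; rewrite geq_max => /andP[].
  - apply: ltW; apply: lt_le_trans (hy k).2 _; rewrite lerD2l.
    by apply: le_trans hN; rewrite lef_pV2 ?posrE// ler_nat ltnS.
have y_low del : 0 < del -> exists N : nat, forall k, (N <= k)%N -> `|y k| <= m + del.
  move=> del0; exists (Num.trunc del^-1) => k Nk.
  apply: ltW; apply: lt_le_trans (hy k).2 _; rewrite lerD2l.
  rewrite -[leRHS]invrK lef_pV2 ?posrE ?invr_gt0//.
  apply: ltW; apply: lt_le_trans (truncnS_gt _) _.
  by rewrite ler_nat ltnS.
have ycvg : cvg (y @ \oo).
  apply/cauchy_cvgP/cauchy_exP => eps eps0.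
  have [del del0 [n hn]] := y_near eps eps0; have [N hN] := y_low _ del0.
  exists (y (maxn n N)); exists n => // k /= nk; rewrite -ball_normE /=.
  rewrite distrC; apply: hn => //; last by apply: hN; rewrite leq_maxr.
  apply: tail_hullS (hy _).1 => j Dj; rewrite geq_max => /andP[nj _].
  by split.
exists (lim (y @ \oo)) => s hs eps eps0.
have eps20 : 0 < eps / 2 by rewrite divr_gt0.
have [del del0 [n hn]] := y_near _ eps20.
have TD : range (d \o s) `<=` D by move=> _ [k _ <-]; exists (s k).
have uT : unbounded (range (d \o s)).
  move=> k; exists (d (s k)); last by exists k.
  by apply: leq_trans (increasing_ge hd _); exact: increasing_ge.
have mdel : m < m + del by rewrite ltrDl.
have [z hz zm] := above _ _ n TD uT mdel.
exists z; first by apply: hullS hz => _ [_ [[k _ <-] _] <-]; exists k.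
move/cvgrPdist_lt/(_ _ eps20) : ycvg => [N _ hN].
have := hn (maxn n N) z (leq_maxl _ _); have := hN (maxn n N) (leq_maxr _ _).
set w := y _ => h1 /(_ _ (ltW zm)) h2.
have -> : z - lim (y @ \oo) = - (w - z) - (lim (y @ \oo) - w).
  by rewrite !opprB addrA subrK.
apply: le_trans (ler_normB _ _) _; rewrite normrN.
have : `|w - z| < eps / 2.
  by apply: h2; apply: tail_hullS hz => j /TD.
by move=> ?; lra.
Qed.

End WeakCompactness.

(** * Demiclosedness of nonexpansive maps *)

Section HullStructure.
Context {R : realType} {E : normedModType R}.

Lemma hull1 (a y : E) : hull [set a] y -> y = a.
Proof.
move=> h; apply: (hull_min (B := [set a]) _ _ h) => //.
by move=> _ _ s -> -> _ _; rewrite -scalerDl subrKC scale1r.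
Qed.

(** One point can be split off a convex combination; this orders the
    points of a combination so that errors can be controlled one point at a time. *)
Lemma hull_cone (a b0 y : E) (B : set E) : B b0 -> hull ([set a] `|` B) y ->
  exists s, exists2 b, hull B b & [/\ 0 <= s, s <= 1 & y = s *: a + (1 - s) *: b].
Proof.
move=> Bb0; pose Q := [set y | exists s : R, exists2 b, hull B b &
  [/\ 0 <= s, s <= 1 & y = s *: a + (1 - s) *: b]].
apply: (@hull_min _ _ _ Q); last first.
  move=> z [->|Bz].
    exists 1, b0; first exact: hull_in.
    by rewrite subrr scale0r addr0 scale1r.
  by exists 0, z; [exact: hull_in|rewrite subr0 scale0r add0r scale1r].
move=> _ _ r [s1 [b1 hb1 [s10 s11 ->]]] [s2 [b2 hb2 [s20 s21 ->]]] r0 r1.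
pose t1 := r * (1 - s1); pose t2 := (1 - r) * (1 - s2).
pose s := r * s1 + (1 - r) * s2.
have t10 : 0 <= t1 by rewrite mulr_ge0// subr_ge0.
have t20 : 0 <= t2 by rewrite mulr_ge0// subr_ge0.
have st : 1 - s = t1 + t2 by rewrite /s /t1 /t2; ring.
have s0 : 0 <= s by rewrite addr_ge0// mulr_ge0// subr_ge0.
have s1' : s <= 1 by rewrite -subr_ge0 st addr_ge0.
have regroup : r *: (s1 *: a + (1 - s1) *: b1) + (1 - r) *: (s2 *: a + (1 - s2) *: b2) =
    s *: a + (t1 *: b1 + t2 *: b2).
  by rewrite !scalerDr !scalerA addrACA -scalerDl.
exists s; rewrite regroup.
have [t0|t0] := eqVneq (t1 + t2) 0.
  exists b1 => //; split=> //; rewrite st t0 scale0r.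
  have /andP[/eqP-> /eqP->] : (t1 == 0) && (t2 == 0).
    by rewrite -paddr_eq0// t0.
  by rewrite !scale0r addr0.
have tp : 0 < t1 + t2 by rewrite lt_def t0 addr_ge0.
exists ((t1 / (t1 + t2)) *: b1 + (1 - t1 / (t1 + t2)) *: b2).
  apply: hull_mix => //; first by rewrite divr_ge0// addr_ge0.
  by rewrite ler_pdivrMr// mul1r lerDl.
split=> //; congr (_ + _); rewrite st scalerDr !scalerA.
by congr (_ *: _ + _ *: _); field.
Qed.

Lemma hull_range_finite (w : nat -> E) y : hull (range w) y ->
  exists m, hull (w @` [set j | (j <= m)%N]) y.
Proof.
elim=> [_ [k _ <-]|{}y z s _ [m hm] _ [n hn] s0 s1].
  by exists k; apply: hull_in; exists k => /=.
exists (maxn m n); apply: hull_mix => //.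
- by apply: hullS hm => _ [j /= jm <-]; exists j => //=; rewrite leq_max jm.
- by apply: hullS hn => _ [j /= jm <-]; exists j => //=; rewrite leq_max jm orbT.
Qed.

End HullStructure.

Section Demiclosedness.
Context {R : realType} {E : normedModType R}.

(** For w on the segment from u to v, both w and T w lie almost as close to u and
    to v as w does.  If w and T w were far apart, their midpoint would be
    definitely closer to u, and u and v would be at distance less than |u - v|. *)
Lemma almost_fixed_mix (D : set E) M eps : uniformly_convex E ->
    (forall u, D u -> `|u| <= M) -> 0 < eps ->
  exists2 del : R, 0 < del <= eps & forall T u v s, nonexpansive_on D T ->
    D u -> D v -> D (s *: u + (1 - s) *: v) -> 0 <= s -> s <= 1 ->
    `|u - T u| <= del -> `|v - T v| <= del ->
    `|s *: u + (1 - s) *: v - T (s *: u + (1 - s) *: v)| <= eps.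
Proof.
move=> uc DM eps0.
have [rho rho0 hrho] := uniformly_convex_scaled (2 * M + 1) uc eps0.
have re0 : 0 < rho * eps by exact: mulr_gt0.
pose del := Num.min (Num.min 1 eps) (rho * eps / 8).
have del0 : 0 < del by rewrite !lt_min ltr01 eps0; lra.
have del1 : del <= 1 by rewrite !ge_min lexx.
have dele : del <= eps by rewrite !ge_min lexx orbT.
have delr : del <= rho * eps / 8 by rewrite ge_min lexx orbT.
exists del; first by rewrite del0.
move=> T u v s nT Du Dv; set w := _ + _ => Dw s0 s1 hu hv.
rewrite leNgt; apply/negP => /ltW hw.
have ew : w - u = (1 - s) *: (v - u).
  by rewrite mix_subr subrr scaler0 add0r.
have ew' : w - v = s *: (u - v).
  by rewrite mix_subr subrr scaler0 addr0.
have wu : `|w - u| = (1 - s) * `|u - v|.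
  by rewrite ew normrZ ger0_norm ?subr_ge0// distrC.
have wv : `|w - v| = s * `|u - v| by rewrite ew' normrZ ger0_norm.
have Twz z : D z -> `|z - T z| <= del -> `|T w - z| <= `|w - z| + del.
  move=> Dz hz; rewrite -(subrK (T z) (T w)) -addrA.
  apply: le_trans (ler_normD _ _) _; rewrite lerD//; first exact: nT.
  by rewrite distrC.
have Twu := Twz _ Du hu; have Twv := Twz _ Dv hv.
have d0 : 0 <= `|u - v| by [].
have dM : `|u - v| <= 2 * M.
  by have := ler_normB u v; have := DM _ Du; have := DM _ Dv; lra.
have sd : (1 - s) * `|u - v| <= `|u - v| by rewrite ler_piMl//; lra.
have r1 : `|w - u| + del <= 2 * M + 1 by rewrite wu; lra.
have hwu : `|w - u| <= `|w - u| + del by rewrite lerDl ltW.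
have wTw : eps <= `|(w - u) - (T w - u)| by rewrite opprB addrA subrK.
have mid1 := hrho _ _ _ r1 hwu Twu wTw.
have mid2 : `|2^-1 *: ((w - v) + (T w - v))| <= `|w - v| + del.
  rewrite normrZ gtr0_norm ?invr_gt0// ler_pdivrMl//.
  by apply: le_trans (ler_normD _ _) _; lra.
have eps_le : eps <= 2 * (`|w - u| + del).
  by apply: le_trans wTw _; apply: le_trans (ler_normB _ _) _; lra.
have : `|u - v| <= (`|w - u| + del) * (1 - rho) + (`|w - v| + del).
  apply: le_trans (lerD mid1 mid2).
  have -> : u - v = 2^-1 *: (w - v + (T w - v)) - 2^-1 *: (w - u + (T w - u)).
    rewrite -scalerBr.
    have -> : w - v + (T w - v) - (w - u + (T w - u)) = (2 : R) *: (u - v).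
      have e (z : E) : z - v - (z - u) = u - v by rewrite opprB addrC addrA subrK.
      by rewrite opprD addrACA !e scaler_nat mulr2n.
    by rewrite scalerA mulVf// scale1r.
  by rewrite [leRHS]addrC; exact: ler_normB.
have : rho * eps <= rho * (2 * (`|w - u| + del)) by rewrite ler_pM2l.
by rewrite wv; nra.
Qed.

(** Along a subsequence the defects |x - T x| decrease so fast that forming convex
    combinations from the last point backwards, one point at a time, only moves
    from the tolerance [del k.+1] to [del k].  All convex combinations then have
    defect at most eps, and l is a limit of such combinations. *)
Lemma demiclosed (D : set E) (T : E -> E) M (v : nat -> E) l :
  uniformly_convex E -> cvx D -> (forall u, D u -> `|u| <= M) ->
  nonexpansive_on D T -> (forall k, D (v k)) -> D l -> hull_cvg v l ->
  (v k - T (v k) @[k --> \oo] --> (0 : E)) -> T l = l.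
Proof.
move=> uc cD DM nT Dv Dl hv hT.
suff small eps : 0 < eps -> `|l - T l| <= 3 * eps.
  apply/esym/eqP; rewrite -subr_eq0 -normr_le0; apply/ler_addgt0Pl => e e0.
  have e30 : 0 < e / 3 by rewrite divr_gt0.
  by rewrite addr0; apply: le_trans (small _ e30) _; lra.
move=> eps0.
have [g hg] : {g : R -> R & forall e, 0 < e -> 0 < g e <= e /\
    forall u v s, D u -> D v -> 0 <= s -> s <= 1 ->
    `|u - T u| <= g e -> `|v - T v| <= g e ->
    `|s *: u + (1 - s) *: v - T (s *: u + (1 - s) *: v)| <= e}.
  apply: (@choice _ _ (fun e d => 0 < e -> 0 < d <= e /\
    forall u v s, D u -> D v -> 0 <= s -> s <= 1 ->
    `|u - T u| <= d -> `|v - T v| <= d ->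
    `|s *: u + (1 - s) *: v - T (s *: u + (1 - s) *: v)| <= e)) => e.
  have [e0|e0] := ltP 0 e; last by exists 0.
  have [d d0 hd] := almost_fixed_mix uc DM e0.
  by exists d => _; split=> // a b s Da Db s0 s1; apply: hd => //; exact: cD.
pose del k := iter k g eps.
have del0 k : 0 < del k.
  by elim: k => // k /hg[/andP[]].
have [s hs sP] : exists2 s : nat -> nat, {homo s : i j / (i < j)%N} &
    forall k, `|v (s k) - T (v (s k))| <= del k.+1.
  apply: (@exists_subsequence (fun i k => `|v k - T (v k)| <= del i.+1)) => i n.
  have /cvgrPdist_le/(_ _ (del0 i.+1))[N _ hN] := hT.
  exists (maxn n N); first exact: leq_maxl.
  by have := hN (maxn n N) (leq_maxr _ _); rewrite /= sub0r normrN.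
have block m : forall k y, hull ((v \o s) @` [set j | (k <= j <= k + m)%N]) y ->
    D y /\ `|y - T y| <= del k.
  elim: m => [|m IH] k y.
    rewrite addn0 => hy.
    have -> : y = v (s k).
      apply: hull1; apply: hullS hy => _ [j /= kjk <-].
      by rewrite (_ : j = k)//; apply/eqP; rewrite eqn_leq andbC.
    split=> //; apply: le_trans (sP k) _.
    by have [/andP[]] := hg _ (del0 k).
  pose B := (v \o s) @` [set j | (k.+1 <= j <= k.+1 + m)%N].
  have Bk : B (v (s k.+1)) by exists k.+1 => //=; rewrite leqnn leq_addr.
  move=> hy; have : hull ([set v (s k)] `|` B) y.
    apply: hullS hy => _ [j /= /andP[kj jm] <-].
    move: kj; rewrite leq_eqVlt => /orP[/eqP->|kj]; first by left.
    by right; exists j => //=; rewrite kj addSnnS.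
  move=> /(hull_cone Bk)[r [b hb [r0 r1 ->]]].
  have [Db hTb] := IH _ _ hb; split; first exact: cD.
  by apply: (hg _ (del0 k)).2 => //; exact: sP.
have [y hy yl] := hv s hs _ eps0.
have [m hm] := hull_range_finite hy.
have [Dy hTy] : D y /\ `|y - T y| <= eps.
  by apply: (block m 0%N); apply: hullS hm => _ [j /= jm <-]; exists j.
have -> : l - T l = - (y - l) + (y - T y) + (T y - T l).
  by rewrite opprB !addrA subrK subrK.
have := nT _ _ Dy Dl; move=> h.
apply: le_trans (ler_normD _ _) _; have := ler_normD (- (y - l)) (y - T y).
by rewrite normrN; lra.
Qed.

End Demiclosedness.

(** * Noncompactness measured by finite partitions *)

Section FiniteNets.

(** Total boundedness criterion for an arbitrary relation, so that it applies to
    the pseudometric comparing the maps V (., x) and V (., y) uniformly. *)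
Lemma finite_net_or_separated (X : eqType) (D : X -> Prop)
    (near_by : X -> X -> Prop) (x0 : X) : D x0 ->
  (exists n (e : 'I_n.+1 -> X), (forall i, D (e i)) /\
     forall x, D x -> exists i, near_by (e i) x) \/
  (exists2 x : nat -> X, forall i, D (x i) &
     forall i j, (i < j)%N -> ~ near_by (x i) (x j)).
Proof.
move=> Dx0; apply: contrapT => /not_orP[nonet nosep]; apply: nosep.
have [pick pickP] : {pick : seq X -> X & forall s, (forall y, y \in s -> D y) ->
    D (pick s) /\ forall y, y \in s -> ~ near_by y (pick s)}.
  apply: (@choice _ _ (fun s x => (forall y, y \in s -> D y) ->
    D x /\ forall y, y \in s -> ~ near_by y x)) => s.
  have [Ds|nDs] := pselect (forall y, y \in s -> D y); last by exists x0.
  apply: contrapT => nox; apply: nonet.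
  exists (size s), (fun i => nth x0 s i); split.
    move=> i; have [is_|si] := ltnP i (size s); first exact/Ds/mem_nth.
    by rewrite nth_default.
  move=> x Dx; apply: contrapT => noi; apply: nox; exists x => _; split=> // y ys.
  move=> nyx; apply: noi; exists (inord (index y s)).
  by rewrite inordK ?nth_index// ltnS index_size.
pose S := fix S k := if k is j.+1 then rcons (S j) (pick (S j)) else [::].
have SD k y : y \in S k -> D y.
  elim: k y => // k IH y; rewrite /= mem_rcons inE => /orP[/eqP->|]; last exact: IH.
  by have [] := pickP _ IH.
exists (fun k => pick (S k)); first by move=> k; have [] := pickP _ (@SD k).
move=> i j ij; have [_] := pickP _ (@SD j); apply.
elim: j ij => // j IH; rewrite ltnS leq_eqVlt /= mem_rcons inE.
by move=> /orP[/eqP->|/IH ->]; rewrite ?eqxx ?orbT.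
Qed.

End FiniteNets.

Section SmallParts.
Context {R : realType} {E : normedModType R}.
Implicit Types (A B K : set E) (d eps : R).

(** Kuratowski's measure of noncompactness of A is the infimum of these d.
    Labellings rather than covers make common refinements products. *)
Definition small_parts A d := exists (I : finType) (f : E -> I),
  forall x y, A x -> A y -> f x = f y -> `|x - y| <= d.

Lemma small_parts_le A d d' : d <= d' -> small_parts A d -> small_parts A d'.
Proof.
move=> dd' [I [f hf]]; exists I, f => x y Ax Ay e.
exact: le_trans (hf _ _ Ax Ay e) dd'.
Qed.

Lemma small_partsS A B d : A `<=` B -> small_parts B d -> small_parts A d.
Proof. by move=> AB [I [f hf]]; exists I, f => x y /AB Bx /AB By; exact: hf. Qed.

Lemma small_parts_rep A d (I : finType) (f : E -> I) a0 : A a0 ->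
  (forall x y, A x -> A y -> f x = f y -> `|x - y| <= d) ->
  exists2 e : I -> E, forall i, A (e i) & forall x, A x -> `|x - e (f x)| <= d.
Proof.
move=> Aa0 hf.
have [e he] : {e : I -> E & forall i, A (e i) /\
    ((exists2 x, A x & f x = i) -> f (e i) = i)}.
  apply: (@choice _ _ (fun i y => A y /\ ((exists2 x, A x & f x = i) -> f y = i))) => i.
  have [[x Ax fx]|nx] := pselect (exists2 x, A x & f x = i); first by exists x.
  by exists a0.
exists e; first by move=> i; exact: (he i).1.
move=> x Ax; apply: hf => //; first exact: (he _).1.
by rewrite (he (f x)).2//; exists x.
Qed.

Lemma small_parts_bounded A d : small_parts A d -> exists M, forall x, A x -> `|x| <= M.
Proof.
move=> [I [f hf]].
have [[a0 Aa0]|nA] := pselect (exists a, A a); last first.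
  by exists 0 => x Ax; case: nA; exists x.
have [e eA he] := small_parts_rep Aa0 hf.
exists (d + \sum_i `|e i|) => x Ax.
rewrite -(subrK (e (f x)) x); apply: le_trans (ler_normD _ _) _.
rewrite lerD// ?he// (bigD1 (f x))//= lerDl; exact: sumr_ge0.
Qed.

Lemma small_parts_closure A d eps : 0 < eps -> small_parts A d ->
  small_parts (closure A) (d + eps).
Proof.
move=> eps0 [I [f hf]].
have eps20 : 0 < eps / 2 by rewrite divr_gt0.
have [a ha] : {a : E -> E & forall x, closure A x -> A (a x) /\ `|x - a x| < eps / 2}.
  apply: (@choice _ _ (fun x a => closure A x -> A a /\ `|x - a| < eps / 2)) => x.
  have [cx|ncx] := pselect (closure A x); last by exists 0.
  have [a [Aa xa]] := cx _ (nbhsx_ballx x _ eps20).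
  by exists a => _; split=> //; move: xa; rewrite -ball_normE.
exists I, (f \o a) => x y /ha[Aax xa] /ha[Aay ya] e.
have -> : x - y = (x - a x) + (a x - a y) + (a y - y).
  by rewrite !addrA subrK subrK.
apply: le_trans (ler_normD _ _) _.
have := ler_normD (x - a x) (a x - a y); have := hf _ _ Aax Aay e.
by rewrite (distrC (a y)); lra.
Qed.

Lemma small_parts_scale A d t : 0 < t -> small_parts A d ->
  small_parts [set t *: x | x in A] (t * d).
Proof.
move=> t0 [I [f hf]]; exists I, (fun z => f (t^-1 *: z)).
move=> _ _ [x Ax <-] [y Ay <-]; rewrite !scalerA mulVf ?gt_eqF// !scale1r => e.
by rewrite -scalerBr normrZ gtr0_norm// ler_pM2l// hf.
Qed.

(** Convex combinations of points of B are grouped by parts: v i is the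
    contribution of part i and b i its total weight.  The relation [H i b v] says
    that v is b times a point common to all balls of radius d that contain part i;
    such points are within d of each other, and H is stable under mixtures.
    Rounding the finitely many weights b i gives the labels. *)
Lemma small_parts_star_hull B d : 0 <= d -> small_parts B d ->
  exists Q : set E, [/\ cvx Q, Q 0,
    forall b s, B b -> 0 <= s -> s <= 1 -> Q (s *: b) &
    forall eps, 0 < eps -> small_parts Q (d + eps)].
Proof.
move=> d0 sB; have [M hM] := small_parts_bounded sB; case: sB => I [f hf].
pose Mp := Num.max M 0.
have Mp0 : 0 <= Mp by rewrite le_max lexx orbT.
have BM z : B z -> `|z| <= Mp by move=> /hM zM; rewrite le_max zM.
pose center i w := forall z, B z -> f z = i -> `|z - w| <= d.
pose H i (b : R) v := 0 <= b /\ forall w, center i w -> `|v - b *: w| <= b * d.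
have H0 i : H i 0 0.
  by split=> // w _; rewrite scale0r subrr normr0 mul0r.
have Hbound i b v : H i b v -> `|v| <= b * (Mp + d).
  move=> [b0 hv].
  have [[z Bz fz]|nz] := pselect (exists2 z, B z & f z = i); last first.
    have c0 : center i 0 by move=> z Bz fz; case: nz; exists z.
    have := hv _ c0; rewrite scaler0 subr0 => h.
    by apply: le_trans h _; rewrite ler_wpM2l// lerDr.
  have cz : center i z by move=> z' Bz' fz'; apply: hf => //; rewrite fz fz'.
  rewrite -(subrK (b *: z) v); apply: le_trans (ler_normD _ _) _.
  rewrite [Mp + d]addrC mulrDr; apply: lerD; first exact: hv.
  by rewrite normrZ ger0_norm//; apply: ler_wpM2l => //; exact: BM.
have Hdiff i b v b' v' : H i b v -> H i b' v' ->
    `|v - v'| <= b' * d + `|b - b'| * (Mp + d).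
  move=> Hv Hv'; have [b0 hv] := Hv; have [b'0 hv'] := Hv'.
  have [eb|nb] := eqVneq b 0.
    have := Hbound _ _ _ Hv; rewrite eb mul0r normr_le0 => /eqP ->.
    rewrite !sub0r !normrN (ger0_norm b'0).
    by apply: le_trans (Hbound _ _ _ Hv') _; rewrite lerDr mulr_ge0.
  have bp : 0 < b by rewrite lt_def nb.
  have cv : center i (b^-1 *: v).
    move=> z Bz fz.
    have cz : center i z by move=> z' Bz' fz'; apply: hf => //; rewrite fz fz'.
    have -> : z - b^-1 *: v = - (b^-1 *: (v - b *: z)).
      by rewrite scalerBr scalerA mulVf// scale1r opprB.
    by rewrite normrN normrZ gtr0_norm ?invr_gt0// ler_pdivrMl// hv.
  have -> : v - v' = (b - b') *: (b^-1 *: v) - (v' - b' *: (b^-1 *: v)).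
    rewrite scalerBl opprB scalerA divff// scale1r.
    by rewrite addrA subrK.
  apply: le_trans (ler_normB _ _) _; rewrite addrC; apply: lerD; first exact: hv'.
  rewrite normrZ; apply: ler_wpM2l => //; rewrite normrZ gtr0_norm ?invr_gt0// ler_pdivrMl//.
  exact: Hbound Hv.
pose rep (b : I -> R) (v : I -> E) y :=
  [/\ forall i, H i (b i) (v i), \sum_i b i <= 1 & y = \sum_i v i].
pose Q := [set y | exists b v, rep b v y].
exists Q; split.
- move=> _ _ s [b [v [Hv b1 ->]]] [b' [v' [Hv' b'1 ->]]] s0 s1.
  have s1' : 0 <= 1 - s by rewrite subr_ge0.
  exists (fun i => s * b i + (1 - s) * b' i), (fun i => s *: v i + (1 - s) *: v' i).
  split.
  + move=> i; have [b0 hv] := Hv i; have [b'0 hv'] := Hv' i; split.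
      by rewrite addr_ge0// mulr_ge0.
    move=> w cw; rewrite [(s * b i + _) *: w]scalerDl -!scalerA opprD addrACA -!scalerBr.
    apply: le_trans (cvx_norm_mix _ _ s0 s1) _.
    rewrite [(s * b i + _) * d]mulrDl -!mulrA.
    by apply: lerD; apply: ler_wpM2l => //; [exact: hv|exact: hv'].
  + rewrite big_split/= -!mulr_sumr -[leRHS](subrKC s 1).
    by rewrite lerD// ler_piMr.
  + by rewrite big_split/= -!scaler_sumr.
- exists (fun=> 0), (fun=> 0); split=> //; first by rewrite big1.
  by rewrite big1.
- move=> z s Bz s0 s1.
  exists (fun i => if i == f z then s else 0), (fun i => if i == f z then s *: z else 0).
  split; last 2 first.
  + by rewrite -big_mkcond big_pred1_eq.
  + by rewrite -big_mkcond big_pred1_eq.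
  + move=> i; case: eqP => [->|//]; split=> // w cw.
    by rewrite -scalerBr normrZ ger0_norm// ler_wpM2l// cw.
- move=> eps eps0.
  have [N NE] : exists N : nat, #|I|%:R * (Mp + d) <= eps * N.+1%:R.
    exists (Num.trunc (#|I|%:R * (Mp + d) / eps)).
    by rewrite [leRHS]mulrC -ler_pdivrMr//; exact/ltW/truncnS_gt.
  pose L : R := N.+1%:R; have L0 : 0 < L by rewrite ltr0n.
  have [bv hbv] : {bv : E -> (I -> R) * (I -> E) & forall y, Q y -> rep (bv y).1 (bv y).2 y}.
    apply: (@choice _ _ (fun y p => Q y -> rep p.1 p.2 y)) => y.
    have [[b [v h]]|nQ] := pselect (Q y); first by exists (b, v).
    by exists (fun=> 0, fun=> 0).
  exists {ffun I -> 'I_N.+2}, (fun y => [ffun i => inord (Num.trunc (L * (bv y).1 i))]).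
  move=> y y' Qy Qy' /ffunP lab.
  have [Hv b1 ->] := hbv _ Qy; have [Hv' b'1 ->] := hbv _ Qy'.
  set b := (bv y).1 in lab Hv b1 *; set v := (bv y).2 in Hv *.
  set b' := (bv y').1 in lab Hv' b'1 *; set v' := (bv y').2 in Hv' *.
  have in_unit (c : I -> R) : (forall i, 0 <= c i) -> \sum_i c i <= 1 ->
      forall i, (Num.trunc (L * c i) < N.+2)%N.
    move=> c0 c1 i; rewrite ltnS -(ler_nat R).
    have ci : c i <= 1.
      by apply: le_trans c1; rewrite (bigD1 i)//= lerDl sumr_ge0.
    apply: le_trans (_ : L * c i <= _); last by rewrite ler_piMr// ltW.
    by rewrite truncn_le mulr_ge0// ltW.
  have close i : `|b i - b' i| <= L^-1.
    have := lab i; rewrite !ffunE => /(congr1 val); rewrite /= !inordK; last 2 first.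
    + by apply: in_unit => // j; exact: (Hv' j).1.
    + by apply: in_unit => // j; exact: (Hv j).1.
    move=> e.
    have bi : 0 <= L * b i by rewrite mulr_ge0 ?(Hv i).1// ltW.
    have b'i : 0 <= L * b' i by rewrite mulr_ge0 ?(Hv' i).1// ltW.
    have /andP[h1 h2] := truncn_itv bi; have /andP[h3 h4] := truncn_itv b'i.
    rewrite e in h1 h2; move: h2 h4; rewrite -natr1 => h2 h4.
    rewrite -[leRHS]mulr1 -ler_pdivrMl ?invr_gt0// invrK.
    rewrite -[L in leLHS]gtr0_norm// -normrM mulrBr ler_norml.
    by apply/andP; split; lra.
  rewrite -sumrB; apply: le_trans (ler_norm_sum _ _ _) _.
  have bnd i : `|v i - v' i| <= b' i * d + L^-1 * (Mp + d).
    apply: le_trans (Hdiff i _ _ _ _ (Hv i) (Hv' i)) _.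
    by rewrite lerD2l ler_wpM2r// addr_ge0.
  apply: le_trans (ler_sum _ (fun i _ => bnd i)) _.
  rewrite big_split/= -mulr_suml sumr_const -mulr_natl lerD//.
    by rewrite ler_piMl.
  by rewrite mulrCA ler_pdivrMl// [leRHS]mulrC.
Qed.

End SmallParts.

(** * Totally bounded invariant sets of condensing maps *)

Section Condensing.
Context {R : realType} {E : normedModType R}.

Lemma closure_cvx (A : set E) : cvx A -> cvx (closure A).
Proof.
move=> cA x y s cx cy s0 s1 B /nbhs_normP[e /= e0 hB].
have [a [Aa xa]] := cx _ (nbhsx_ballx x _ e0).
have [b [Ab yb]] := cy _ (nbhsx_ballx y _ e0).
exists (s *: a + (1 - s) *: b); split; first exact: cA.
apply: hB => /=; move: xa yb; rewrite -!ball_normE /= => xa yb.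
have -> : s *: x + (1 - s) *: y - (s *: a + (1 - s) *: b) =
    s *: (x - a) + (1 - s) *: (y - b).
  by rewrite opprD addrACA -!scalerBr.
apply: le_lt_trans (cvx_norm_mix _ _ s0 s1) _.
set m := Num.max `|x - a| `|y - b|.
have xm : `|x - a| <= m by rewrite le_max lexx.
have ym : `|y - b| <= m by rewrite le_max lexx orbT.
have me : m < e by rewrite gt_max xa.
have := ler_wpM2l s0 xm; have s0' : 0 <= 1 - s by rewrite subr_ge0.
by have := ler_wpM2l s0' ym; lra.
Qed.

(** Let K be the least closed convex G-invariant set containing 0.  A closed
    convex set containing all segments from 0 to the points t H x, for x in K, meets
    K in another such set, so it contains K by minimality.  It can be chosen hardly
    less compact than these points; so the noncompactness a of K satisfies
    a <= t a, and a = 0. *)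
Lemma exists_totally_bounded_invariant (C : set E) (G H : E -> E) M t :
    0 < t -> t < 1 -> closed C -> cvx C -> C 0 -> (forall x, C x -> `|x| <= M) ->
    (forall x, C x -> C (G x)) ->
    (forall x, C x -> exists2 s, 0 <= s <= 1 & G x = s *: (t *: H x)) ->
    (forall K d eps, K `<=` C -> 0 < eps -> small_parts K d ->
       small_parts (H @` K) (d + eps)) ->
  exists K : set E, [/\ closed K, cvx K, K 0, K `<=` C &
    (forall x, K x -> K (G x)) /\ forall d, 0 < d -> small_parts K d].
Proof.
move=> t0 t1 clC cC C0 CM GC Gs HK.
pose good A := [/\ closed A, cvx A, A 0, A `<=` C & forall x, A x -> A (G x)].
pose K := [set x | forall A, good A -> A x].
have Kmin A : good A -> K `<=` A by move=> gA x; apply.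
have goodC : good C by split.
have KC : K `<=` C by exact: Kmin.
have goodK : good K.
  split=> //.
  - move=> x cx A gA; have [clA _ _ _ _] := gA; apply: clA.
    by apply: closure_subset cx; exact: Kmin.
  - move=> x y s Kx Ky s0 s1 A gA; have [_ cA _ _ _] := gA.
    by apply: cA => //; [exact: Kx|exact: Ky].
  - by move=> A [].
  - by move=> x Kx A gA; have [_ _ _ _] := gA; apply; exact: Kx.
exists K; case: (goodK) => clK cK K0 _ KG; split=> //; split=> //.
have shrink d d' : 0 <= d -> t * d < d' -> small_parts K d -> small_parts K d'.
  move=> d0 dd' sK.
  have sB e : 0 < e -> small_parts [set t *: x | x in H @` K] (t * d + e).
    move=> e0; have et0 : 0 < e / t by rewrite divr_gt0.
    have := small_parts_scale t0 (HK _ _ _ KC et0 sK).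
    by rewrite mulrDr (mulrC t (e / t)) divfK// gt_eqF.
  pose e := (d' - t * d) / 3.
  have e0 : 0 < e by rewrite /e; lra.
  have tde : 0 <= t * d + e by rewrite addr_ge0 ?(ltW e0)// mulr_ge0 ?(ltW t0).
  have [Q [cQ Q0 QB sQ]] := small_parts_star_hull tde (sB _ e0).
  have : K `<=` K `&` closure Q.
    apply: Kmin; split.
    - by apply: closedI => //; exact: closed_closure.
    - move=> x y s [Kx Qx] [Ky Qy] s0 s1; split; first exact: cK.
      exact: closure_cvx.
    - by split=> //; exact: subset_closure.
    - by move=> x [/KC].
    - move=> x [Kx _]; split; first exact: KG.
      apply: subset_closure.
      have [s /andP[s0 s1] ->] := Gs _ (KC _ Kx).
      by apply: QB => //; exists (H x) => //; exists x.
  move=> KQ; apply: small_partsS (_ : K `<=` closure Q) _; first by move=> x /KQ[].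
  apply: small_parts_le (small_parts_closure e0 (sQ _ e0)).
  by rewrite /e; lra.
pose D := [set d | 0 <= d /\ small_parts K d].
have M0 : 0 <= M by apply: le_trans (CM _ C0).
have infD : has_inf D.
  split; last by exists 0 => d [].
  exists (2 * M); split; first by rewrite mulr_ge0.
  exists unit, (fun=> tt) => x y /KC/CM xM /KC/CM yM _.
  by apply: le_trans (ler_normB _ _) _; lra.
have inf0 : 0 <= inf D by apply: lb_le_inf; [exact: infD.1|move=> d []].
move=> d d0.
suff e : inf D < d.
  have de : 0 < d - inf D by rewrite subr_gt0.
  have [d1 [_ sd1] lt1] := inf_adherent de infD.
  by apply: small_parts_le sd1; rewrite addrC subrK in lt1; exact: ltW.
apply: le_lt_trans d0; rewrite leNgt; apply/negP => a0.
have e0 : 0 < (1 - t) * inf D / 3 by rewrite divr_gt0// mulr_gt0// subr_gt0.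
have [d1 [d10 sd1] lt1] := inf_adherent e0 infD.
have : inf D <= inf D - (1 - t) * inf D / 3.
  apply: ge_inf; first by case: infD.
  split; first by nra.
  by apply: (shrink _ _ d10 _ sd1); nra.
by lra.
Qed.

End Condensing.

(** * Schauder's fixed point theorem *)

Section Schauder.
Context {R : realType} {E : completeNormedModType R}.

Lemma pigeonhole_subsequence (I : finType) (f : nat -> I) :
  exists i, forall N, exists2 k, (N <= k)%N & f k = i.
Proof.
apply: contrapT => no.
have [B hB] : {B : I -> nat & forall i k, (B i <= k)%N -> f k <> i}.
  apply: (@choice _ _ (fun i N => forall k, (N <= k)%N -> f k <> i)) => i.
  apply: contrapT => nN; apply: no; exists i => N; apply: contrapT => nk.
  by apply: nN; exists N => k Nk fk; apply: nk; exists k.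
pose N := (\max_i B i)%N.
exact: (hB (f N) N (leq_bigmax _)).
Qed.

(** Infinitely many terms lie in one small part, and l is close to their hull. *)
Lemma hull_cvg_cluster (K : set E) (v : nat -> E) l :
  (forall d, 0 < d -> small_parts K d) -> (forall k, K (v k)) -> hull_cvg v l ->
  forall eps, 0 < eps -> forall N, exists2 k, (N <= k)%N & `|v k - l| <= eps.
Proof.
move=> tbK Kv hv eps eps0 N.
have eps20 : 0 < eps / 2 by rewrite divr_gt0.
have [I [f hf]] := tbK _ eps20.
have [i hi] := pigeonhole_subsequence (f \o v).
have [s hs sP] := @exists_subsequence (fun _ k => f (v k) = i) (fun _ => hi).
have [y hy yl] := hv s hs _ eps20.
exists (s N); first exact: increasing_ge.
have : `|y - v (s N)| <= eps / 2.
  apply: (hull_min (@cvx_ball _ _ (v (s N)) (eps / 2)) _ hy) => _ [k _ <-] /=.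
  by apply: hf; rewrite ?sP.
move=> h; have -> : v (s N) - l = - (y - v (s N)) + (y - l).
  by rewrite opprB addrA subrK.
by apply: le_trans (ler_normD _ _) _; rewrite normrN; lra.
Qed.

(** The points x_k that are close to the hull of the images of their neighbours
    accumulate at some l; by continuity these images are close to G l. *)
Lemma schauder_totally_bounded (K : set E) (G : E -> E) M : uniformly_convex E ->
    closed K -> cvx K -> K 0 -> (forall x, K x -> `|x| <= M) ->
    (forall d, 0 < d -> small_parts K d) -> (forall x, K x -> K (G x)) ->
    (forall x, K x -> forall eps, 0 < eps -> exists2 del, 0 < del &
       forall y, K y -> `|y - x| <= del -> `|G y - G x| <= eps) ->
  exists2 x, K x & G x = x.
Proof.
move=> uc clK cK K0 KM tbK KG contG.
have approx (eps : R) : 0 < eps -> exists2 x, K x &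
    exists2 y, hull (G @` [set x' | K x' /\ `|x' - x| <= eps]) y &
    `|x - y| <= 2 * eps.
  move=> eps0; have [I [f hf]] := tbK _ eps0.
  have [e Ke he] := small_parts_rep K0 hf.
  apply: (@approximate_fixed_point _ _ K G #|I|
    (fun i => e (nth (f 0) (enum I) i))) => // x Kx.
  exists (inord (enum_rank (f x))).
  by rewrite inordK ?nth_enum_rank ?he// ltnS ltnW.
pose epsk k : R := k.+1%:R^-1.
have epsk0 k : 0 < epsk k by rewrite invr_gt0.
have [x hx] : {x : nat -> E & forall k, K (x k) /\
    exists2 y, hull (G @` [set x' | K x' /\ `|x' - x k| <= epsk k]) y &
    `|x k - y| <= 2 * epsk k}.
  apply: (@choice _ _ (fun k x => K x /\
    exists2 y, hull (G @` [set x' | K x' /\ `|x' - x| <= epsk k]) y &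
    `|x - y| <= 2 * epsk k)) => k.
  by have [z Kz hz] := approx _ (epsk0 k); exists z.
have Kx k : K (x k) by exact: (hx k).1.
have [d hd [l hl]] := bounded_hull_cvg_subsequence uc (fun k => KM _ (Kx k)).
have Kl : K l by apply: (hull_cvg_closed_cvx clK cK _ hl) => j; exact: Kx.
exists l => //.
suff small eta : 0 < eta -> `|l - G l| <= 3 * eta.
  apply/esym/eqP; rewrite -subr_eq0 -normr_le0; apply/ler_addgt0Pl => e e0.
  have e30 : 0 < e / 3 by rewrite divr_gt0.
  by rewrite addr0; apply: le_trans (small _ e30) _; lra.
move=> eta0; have [del0 del00 hdel0] := contG _ Kl _ eta0.
pose del := Num.min del0 eta.
have del_gt0 : 0 < del by rewrite lt_min del00.
have dele : del <= eta by rewrite ge_min lexx orbT.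
have hdel y : K y -> `|y - l| <= del -> `|G y - G l| <= eta.
  by move=> Ky yl; apply: hdel0 => //; apply: le_trans yl _; rewrite ge_min lexx.
have del2 : 0 < del / 2 by rewrite divr_gt0.
pose N := Num.trunc (del / 2)^-1.
have [k Nk xkl] := hull_cvg_cluster tbK (fun k => Kx (d k)) hl del2 N.
have ek : epsk (d k) <= del / 2.
  rewrite -[leRHS]invrK lef_pV2 ?posrE ?invr_gt0//.
  apply: ltW; apply: lt_le_trans (truncnS_gt _) _.
  by rewrite ler_nat ltnS; apply: leq_trans Nk _; exact: increasing_ge.
have [y hy xy] := (hx (d k)).2.
have yGl : `|y - G l| <= eta.
  apply: (hull_min (@cvx_ball _ _ (G l) eta) _ hy) => _ [z [Kz zx] <-] /=.
  apply: hdel => //; rewrite -(subrK (x (d k)) z) -addrA.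
  by apply: le_trans (ler_normD _ _) _; lra.
have -> : l - G l = - (x (d k) - l) + (x (d k) - y) + (y - G l).
  by rewrite opprB !addrA subrK subrK.
apply: le_trans (ler_normD _ _) _.
by have := ler_normD (- (x (d k) - l)) (x (d k) - y); rewrite normrN; lra.
Qed.

End Schauder.

(** * Gauge of a convex body and radial retraction *)

Section Gauge.
Context {R : realType} {E : normedModType R}.
Variables (C : set E) (rho : R).
Hypotheses (clC : closed C) (cC : cvx C) (rho0 : 0 < rho)
  (ballC : forall x, `|x| < rho -> C x).

Let C0 : C 0. Proof. by apply: ballC; rewrite normr0. Qed.

Definition gauge (x : E) : R := inf [set c | 0 < c /\ C (c^-1 *: x)].

Lemma gauge_le c x : 0 < c -> C (c^-1 *: x) -> gauge x <= c.
Proof.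
by move=> c0 Ccx; apply: ge_inf; [exists 0 => ? [/ltW]|].
Qed.

Lemma gauge_has_inf x : has_inf [set c | 0 < c /\ C (c^-1 *: x)].
Proof.
split; last by exists 0 => c [/ltW].
have c0 : 0 < `|x| / rho + 1 by rewrite ltr_wpDl// divr_ge0// ltW.
exists (`|x| / rho + 1); split=> //; apply: ballC.
rewrite normrZ gtr0_norm ?invr_gt0// ltr_pdivrMl//.
by rewrite mulrDl divfK ?gt_eqF// mul1r ltrDl.
Qed.

Lemma gauge_lt c x : gauge x < c -> 0 < c /\ C (c^-1 *: x).
Proof.
move=> xc; have d0 : 0 < c - gauge x by rewrite subr_gt0.
have [c' [c'0 Cc'] ltc'] := inf_adherent d0 (gauge_has_inf x).
rewrite -/(gauge x) subrKC in ltc'.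
have c0 : 0 < c by exact: lt_trans ltc'.
split=> //; have -> : c^-1 *: x = (c' / c) *: (c'^-1 *: x) + (1 - c' / c) *: 0.
  by rewrite scaler0 addr0 scalerA mulrAC divff ?gt_eqF// mul1r.
apply: cC => //; first by rewrite divr_ge0// ltW.
by rewrite ler_pdivrMr// mul1r ltW.
Qed.

(** The gauge is subadditive, and at most |x| / rho because C contains the ball of
    radius rho. *)
Lemma gauge_lipschitz x y : gauge x <= gauge y + `|x - y| / rho.
Proof.
apply/ler_addgt0Pl => e e0.
pose c := gauge y + e / 2; pose d := `|x - y| / rho + e / 2.
have [c0 Cy] : 0 < c /\ C (c^-1 *: y) by apply: gauge_lt; rewrite /c; lra.
have d0 : 0 < d by rewrite /d ltr_wpDl ?divr_gt0// divr_ge0// ltW.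
have Cxy : C (d^-1 *: (x - y)).
  apply: ballC; rewrite normrZ gtr0_norm ?invr_gt0// ltr_pdivrMl//.
  by rewrite /d mulrDl divfK ?gt_eqF// ltrDl mulr_gt0// divr_gt0.
have cd0 : 0 < c + d by exact: addr_gt0.
have -> : e + (gauge y + `|x - y| / rho) = c + d by rewrite /c /d; lra.
apply: gauge_le => //.
have -> : (c + d)^-1 *: x =
    (c / (c + d)) *: (c^-1 *: y) + (1 - c / (c + d)) *: (d^-1 *: (x - y)).
  have -> : 1 - c / (c + d) = d / (c + d).
    by move: (c) (d) cd0 => a b ab0; field; rewrite gt_eqF.
  rewrite !scalerA mulrAC divff ?gt_eqF// mulrAC divff ?gt_eqF// mul1r.
  by rewrite -scalerDr subrKC.
apply: cC => //; first by rewrite divr_ge0// ltW.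
by rewrite ler_pdivrMr// mul1r lerDl ltW.
Qed.

Definition radial (x : E) : E := (Num.max 1 (gauge x))^-1 *: x.

Let maxg_ge1 x : 1 <= Num.max 1 (gauge x).
Proof. by rewrite le_max lexx. Qed.

Let maxg_gt0 x : 0 < Num.max 1 (gauge x).
Proof. exact: lt_le_trans (maxg_ge1 x). Qed.

Lemma radial_in x : C (radial x).
Proof.
rewrite (closure_id C).1// => B /nbhs_normP[eps /= eps0 hB].
pose q := Num.max 1 (gauge x); have q0 : 0 < q := maxg_gt0 x.
have q1 : 1 <= q := maxg_ge1 x.
have x1 : 0 < `|x| + 1 by rewrite ltr_wpDl.
pose e := eps / (`|x| + 1); have e0 : 0 < e by rewrite divr_gt0.
exists ((q + e)^-1 *: x); split.
  apply: (gauge_lt _).2; apply: (@le_lt_trans _ _ q); last by rewrite ltrDl.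
  by rewrite le_max lexx orbT.
apply: hB => /=; rewrite -scalerBl normrZ.
have qe0 : 0 < q + e by rewrite addr_gt0.
have -> : q^-1 - (q + e)^-1 = e / (q * (q + e)) by field; rewrite !gt_eqF.
have qq0 : 0 < q * (q + e) by exact: mulr_gt0.
rewrite gtr0_norm ?divr_gt0//; apply: (@le_lt_trans _ _ (e * `|x|)).
  rewrite ler_wpM2r// ler_pdivrMr// ler_peMr//; first exact: ltW.
  by nra.
by rewrite /e mulrAC ltr_pdivrMr// ltr_pM2l// ltrDl.
Qed.

Lemma radial_lipschitz x y : `|radial x - radial y| <= `|x - y| * (1 + `|y| / rho).
Proof.
rewrite /radial; set p := Num.max 1 (gauge x); set q := Num.max 1 (gauge y).
have p1 : 1 <= p := maxg_ge1 x; have q1 : 1 <= q := maxg_ge1 y.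
have p0 : 0 < p := maxg_gt0 x; have q0 : 0 < q := maxg_gt0 y.
have d0 : 0 <= `|x - y| / rho by rewrite divr_ge0// ltW.
have pq : `|p - q| <= `|x - y| / rho.
  have h1 := gauge_lipschitz x y; have h2 := gauge_lipschitz y x.
  rewrite (distrC y) in h2.
  have pg : gauge x <= p by rewrite le_max lexx orbT.
  have qg : gauge y <= q by rewrite le_max lexx orbT.
  have le1 : p <= q + `|x - y| / rho by rewrite ge_max; apply/andP; split; lra.
  have le2 : q <= p + `|x - y| / rho by rewrite ge_max; apply/andP; split; lra.
  by rewrite ler_norml; apply/andP; split; lra.
have -> : p^-1 *: x - q^-1 *: y = p^-1 *: (x - y) + (p^-1 - q^-1) *: y.
  by rewrite scalerBr scalerBl addrA subrK.
apply: le_trans (ler_normD _ _) _; rewrite mulrDr mulr1 !normrZ; apply: lerD.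
  rewrite gtr0_norm ?invr_gt0// ler_piMl// invf_le1//.
rewrite mulrA [leRHS]mulrAC; apply: ler_wpM2r => //.
have -> : p^-1 - q^-1 = (q - p) / (p * q) by field; rewrite !gt_eqF.
rewrite normrM distrC [X in _ * X]gtr0_norm ?invr_gt0 ?mulr_gt0//.
apply: le_trans pq; rewrite ler_piMr// invf_le1 ?mulr_gt0//.
by nra.
Qed.

(** A point of gauge more than 1 is sent to gauge exactly 1, whereas multiplying an
    interior point by some 1 + d stays in C. *)
Lemma radial_fixed x : 1 < gauge x -> ~ interior C (radial x).
Proof.
move=> x1; have mx : Num.max 1 (gauge x) = gauge x by apply/max_idPr/ltW.
rewrite /radial mx; set q := gauge x in x1 mx *; set z := _ *: _.
move=> /nbhs_normP[e /= e0 hC].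
have q0 : 0 < q by lra.
have z1 : 0 < 2 * (`|z| + 1) by rewrite mulr_gt0// ltr_wpDl.
pose d := e / (2 * (`|z| + 1)); have d0 : 0 < d by rewrite divr_gt0.
have Cz : C ((1 + d) *: z).
  apply: hC => /=; rewrite scalerDl scale1r opprD addrA subrr sub0r normrN.
  rewrite normrZ gtr0_norm// /d mulrAC ltr_pdivrMr// ltr_pM2l//.
  have := normr_ge0 z; lra.
have d1 : 0 < 1 + d by lra.
have : q <= q / (1 + d).
  apply: gauge_le; first by rewrite divr_gt0.
  by rewrite invfM invrK mulrC -scalerA.
by rewrite ler_pdivlMr// ger_pMr//; lra.
Qed.

End Gauge.

(** * Semicontractive maps do not increase noncompactness *)

Section Semicontractive.
Context {R : realType} {E : completeNormedModType R}.
Variables (C : set E) (M : R) (V : E -> E -> E).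
Hypotheses (uc : uniformly_convex E) (clC : closed C) (cC : cvx C) (C0 : C 0)
  (CM : forall x, C x -> `|x| <= M)
  (V_nonexp : forall x, C x -> nonexpansive_on C (fun u => V u x))
  (V_cc : completely_continuous_uniformly C V).

Lemma bounded_range (u : nat -> E) : (forall j, C (u j)) -> bounded_set (range u).
Proof.
move=> Cu; exists M; split; first exact: num_real.
by move=> N MN _ [j _ <-]; apply: le_trans (ltW MN); exact/CM/Cu.
Qed.

(** Otherwise there is a sequence with V (., x_i) and V (., x_j) uniformly apart.
    On a weakly convergent subsequence choose points u_j witnessing this for
    consecutive indices; complete continuity brings both values to V u_j l. *)
Lemma precompact_second_variable eps : 0 < eps ->
  exists (I : finType) (g : E -> I), forall x y u, C x -> C y -> C u ->
    g x = g y -> `|V u x - V u y| <= eps.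
Proof.
move=> eps0; have eps20 : 0 < eps / 2 by rewrite divr_gt0.
have [[n [e [_ net]]]|[x Cx sep]] := finite_net_or_separated
    (fun x y => forall u, C u -> `|V u x - V u y| <= eps / 2) C0.
  have [g hg] : {g : E -> 'I_n.+1 & forall x, C x ->
      forall u, C u -> `|V u (e (g x)) - V u x| <= eps / 2}.
    apply: (@choice _ _ (fun x i => C x ->
      forall u, C u -> `|V u (e i) - V u x| <= eps / 2)) => x.
    have [Cx|nCx] := pselect (C x); last by exists ord0.
    by have [i hi] := net _ Cx; exists i.
  exists 'I_n.+1, g => x y u Cx Cy Cu gxy.
  have h1 := hg _ Cx _ Cu; have h2 := hg _ Cy _ Cu; rewrite gxy in h1.
  have -> : V u x - V u y = (V u (e (g y)) - V u y) - (V u (e (g y)) - V u x).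
    by rewrite opprB [RHS]addrC addrA subrK.
  by apply: le_trans (ler_normB _ _) _; lra.
have [d hd [l hl]] := bounded_hull_cvg_subsequence uc (fun k => CM (Cx k)).
have Cl : C l by apply: (hull_cvg_closed_cvx clC cC _ hl) => j; exact: Cx.
have [u hu] : {u : nat -> E & forall j, C (u j) /\
    eps / 2 < `|V (u j) (x (d j)) - V (u j) (x (d j.+1))|}.
  apply: (@choice _ _ (fun j w => C w /\
    eps / 2 < `|V w (x (d j)) - V w (x (d j.+1))|)) => j.
  apply: contrapT => no; apply: (sep (d j) (d j.+1)); first exact: hd.
  move=> w Cw; rewrite leNgt; apply/negP => lt; apply: no.
  by exists w.
have Cu j : C (u j) by exact: (hu j).1.
have hS : {homo S : i j / (i < j)%N} by move=> i j.
have c1 := V_cc Cu (bounded_range Cu) (fun j => Cx (d j)) Cl (hull_cvg_weakly hl).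
have c2 := V_cc Cu (bounded_range Cu) (fun j => Cx (d j.+1)) Cl
  (hull_cvg_weakly (hull_cvg_subsequence hS hl)).
have eps40 : 0 < eps / 4 by rewrite divr_gt0.
move/cvgrPdist_le/(_ _ eps40) : c1 => [N1 _ hN1].
move/cvgrPdist_le/(_ _ eps40) : c2 => [N2 _ hN2].
pose N := maxn N1 N2.
have := hN1 N (leq_maxl _ _); have := hN2 N (leq_maxr _ _).
rewrite /= !sub0r !normrN => h2 h1.
have := (hu N).2; rewrite ltNge => /negP; case.
have -> : V (u N) (x (d N)) - V (u N) (x (d N.+1)) =
    (V (u N) (x (d N)) - V (u N) l) - (V (u N) (x (d N.+1)) - V (u N) l).
  by rewrite opprB addrA subrK.
by apply: le_trans (ler_normB _ _) _; lra.
Qed.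

(** On a part of K refined by the labels of the second variable, V x x and V y y
    differ by at most |x - y| in the first variable and eps in the second. *)
Lemma small_parts_semicontractive (F : E -> E) K d eps :
  (forall x, C x -> F x = V x x) -> K `<=` C -> 0 < eps -> small_parts K d ->
  small_parts (F @` K) (d + eps).
Proof.
move=> FV KC eps0 [I [f hf]].
have [J [g hg]] := precompact_second_variable eps0.
have [h hh] : {h : E -> E & forall z, (F @` K) z -> K (h z) /\ F (h z) = z}.
  apply: (@choice _ _ (fun z x => (F @` K) z -> K x /\ F x = z)) => z.
  have [[x Kx Fx]|nz] := pselect ((F @` K) z); first by exists x.
  by exists 0 => z'.
exists (I * J)%type, (fun z => (f (h z), g (h z))) => z z' /hh[Kz Fz] /hh[Kz' Fz'] [ef eg].
rewrite -Fz -Fz' !FV; [|exact: KC..].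
move: (h z) (h z') Kz Kz' ef eg => x y Kx Ky fxy gxy.
have Cx := KC _ Kx; have Cy := KC _ Ky.
rewrite -(subrK (V y x) (V x x)) -addrA; apply: le_trans (ler_normD _ _) _.
apply: lerD; last exact: hg.
by apply: le_trans (V_nonexp Cx Cx Cy) _; exact: hf.
Qed.

End Semicontractive.

(** * Fixed points under the Leray-Schauder condition *)

Section LeraySchauder.
Context {R : realType} {E : completeNormedModType R}.

(** A fixed point x of the retracted map r (t F) is a fixed point of t F: if the
    gauge q of t F x exceeds 1, then x is on the boundary and (q / t) x = F x. *)
Lemma leray_schauder_scaled (C : set E) (F : E -> E) (V : E -> E -> E)
    (rho M t : R) :
    uniformly_convex E -> closed C -> cvx C ->
    0 < rho -> (forall x, `|x| < rho -> C x) -> (forall x, C x -> `|x| <= M) ->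
    (forall x, C x -> F x = V x x) ->
    (forall x, C x -> nonexpansive_on C (fun u => V u x)) ->
    completely_continuous_uniformly C V ->
    {within C, continuous F} ->
    (forall x, boundary C x -> forall lambda : R, 1 < lambda -> lambda *: x <> F x) ->
    0 < t -> t < 1 ->
  exists2 x, C x & t *: F x = x.
Proof.
move=> uc clC cC rho0 ballC CM FV Vn Vcc contF LS t0 t1.
have C0 : C 0 by apply: ballC; rewrite normr0.
pose r := radial C; pose G x := r (t *: F x).
have rC x : C (r x) by exact: radial_in rho0 ballC x.
have HK K d eps : K `<=` C -> 0 < eps -> small_parts K d ->
    small_parts (F @` K) (d + eps).
  exact: (small_parts_semicontractive uc clC cC C0 CM Vn Vcc FV).
have [K [clK cK K0 KC [KG tbK]]] : exists K : set E,
    [/\ closed K, cvx K, K 0, K `<=` C &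
      (forall x, K x -> K (G x)) /\ forall d, 0 < d -> small_parts K d].
  apply: (exists_totally_bounded_invariant t0 t1 clC cC C0 CM _ _ HK) => x Cx.
    exact: rC.
  exists (Num.max 1 (gauge C (t *: F x)))^-1 => //.
  have q1 : 1 <= Num.max 1 (gauge C (t *: F x)) by rewrite le_max lexx.
  have q0 := lt_le_trans ltr01 q1.
  by rewrite invr_ge0 ltW//= invf_le1.
have contG x : K x -> forall eps, 0 < eps -> exists2 del, 0 < del &
    forall y, K y -> `|y - x| <= del -> `|G y - G x| <= eps.
  move=> Kx eps eps0.
  pose B := 1 + `|t *: F x| / rho.
  have B0 : 0 < B by rewrite ltr_wpDr// divr_ge0// ltW.
  have e0 : 0 < eps / B by rewrite divr_gt0.
  move/subspace_continuousP/(_ x (KC _ Kx))/cvgrPdist_le/(_ _ e0) : contF.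
  rewrite /= near_withinE => /nbhs_normP[del /= del0 hdel].
  exists (del / 2); first by rewrite divr_gt0.
  move=> y Ky yx; apply: le_trans (radial_lipschitz cC rho0 ballC _ _) _.
  rewrite -ler_pdivlMr// -scalerBr normrZ gtr0_norm//.
  apply: le_trans (_ : `|F y - F x| <= _); first by rewrite ler_piMl// ltW.
  rewrite distrC; apply: hdel; last exact: KC.
  by rewrite /= distrC; apply: le_lt_trans yx _; lra.
have [x Kx Gx] := schauder_totally_bounded uc clK cK K0 (fun x Kx => CM _ (KC _ Kx))
  tbK KG contG.
exists x; first exact: KC.
move: Gx; rewrite /G /r /radial.
have [g1|g1] := leP (gauge C (t *: F x)) 1.
  by rewrite invr1 scale1r.
set q := gauge C _ in g1 * => qx.
have q0 : 0 < q by exact: lt_trans g1.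
have Fx : (q / t) *: x = F x.
  rewrite -[in LHS]qx !scalerA -[RHS]scale1r; congr (_ *: _).
  by rewrite mulrAC divfK ?divff ?gt_eqF.
exfalso; apply: (LS x _ (q / t)) => //; last first.
  by rewrite ltr_pdivlMr// mul1r; exact: lt_trans g1.
split; first by apply: subset_closure; exact: KC.
have := radial_fixed g1.
by rewrite /radial (max_idPr _) ?ltW// qx.
Qed.

End LeraySchauder.

Theorem theorem7p6 (R : realType) (E : completeNormedModType R)
    (U : set E) (F : E -> E) :
  uniformly_convex E ->
  bounded_set U -> open U -> convex_set (U : set (convex_lmodType E)) -> U 0 ->
  semicontractive (closure U) F ->
  {within closure U, continuous F} ->
  (forall x, boundary (closure U) x ->
     forall lambda : R, 1 < lambda -> lambda *: x <> F x) ->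
  exists2 x, closure U x & F x = x.
Proof.
move=> uc bU oU convU U0 [V [FV Vn Vcc]] contF LS.
set C := closure U in FV Vn Vcc contF LS *.
have clC : closed C by exact: closed_closure.
have cU : cvx U.
  move=> x y s Ux Uy s0 s1.
  have := convU x y (Itv01 s0 s1); rewrite !inE; exact.
have cC : cvx C by exact: closure_cvx.
have [rho rho0 ballC] : exists2 rho : R, 0 < rho & forall x, `|x| < rho -> C x.
  have /nbhs_normP[rho /= rho0 hU] : nbhs (0 : E) U by apply: open_nbhs_nbhs.
  exists rho => // x xr; apply: subset_closure; apply: hU => /=.
  by rewrite sub0r normrN.
have [M CM] : exists M, forall x, C x -> `|x| <= M.
  have [M0 [_ /(_ (M0 + 1))]] := bU; rewrite ltrDl => /(_ ltr01) hM.
  exists (M0 + 1 + 1) => x cx.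
  have [y [Uy xy]] := cx _ (nbhsx_ballx x _ (@ltr01 R)).
  rewrite -ball_normE /= in xy; rewrite -(subrK y x).
  apply: le_trans (ler_normD _ _) _; rewrite addrC lerD//; last exact: ltW.
  exact: hM.
have [x hx] : {x : nat -> E & forall k, C (x k) /\
    (k.+1%:R / k.+2%:R : R) *: F (x k) = x k}.
  apply: (@choice _ _ (fun k z => C z /\ (k.+1%:R / k.+2%:R : R) *: F z = z)) => k.
  have [||z Cz Fz] := @leray_schauder_scaled _ _ C F V rho M
    (k.+1%:R / k.+2%:R) uc clC cC rho0 ballC CM FV Vn Vcc contF LS.
  - by rewrite divr_gt0.
  - by rewrite ltr_pdivrMr// mul1r ltr_nat.
  - by exists z.
have Cx k : C (x k) by exact: (hx k).1.
have almost k : `|x k - F (x k)| <= M * k.+1%:R^-1.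
  have k1 : (k.+1%:R : R) != 0 by rewrite pnatr_eq0.
  have k2 : (k.+2%:R : R) != 0 by rewrite pnatr_eq0.
  have -> : x k - F (x k) = - (k.+1%:R^-1 *: x k).
    have -> : F (x k) = (k.+2%:R / k.+1%:R) *: x k.
      by rewrite -{2}(hx k).2 scalerA mulrA divfK// divff// scale1r.
    rewrite -{1}[x k]scale1r -scalerBl -[RHS]scaleNr; congr (_ *: _).
    by rewrite -[k.+2%:R]natr1; field.
  by rewrite normrN normrZ gtr0_norm ?invr_gt0// mulrC ler_wpM2r// CM.
have [d hd [l hl]] := bounded_hull_cvg_subsequence uc (fun k => CM _ (Cx k)).
have Cl : C l by apply: (hull_cvg_closed_cvx clC cC _ hl) => j; exact: Cx.
have Cv j : C ((x \o d) j) by exact: Cx.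
have resid : (x \o d) j - F ((x \o d) j) @[j --> \oo] --> (0 : E).
  apply/cvgrPdist_le => eps eps0.
  exists (Num.trunc (M / eps)) => // j /= Nj; rewrite sub0r normrN.
  apply: le_trans (almost _) _; rewrite ler_pdivrMr// mulrC -ler_pdivrMr//.
  apply: ltW; apply: lt_le_trans (truncnS_gt _) _.
  by rewrite ler_nat ltnS; apply: leq_trans Nj _; exact: increasing_ge.
have cc := Vcc _ _ _ Cv (bounded_range CM Cv) Cv Cl (hull_cvg_weakly hl).
exists l => //; rewrite FV//.
apply: (@demiclosed _ _ C (fun u => V u l) M (x \o d)) => //; first exact: Vn.
have sum_cvg := cvgD resid cc; rewrite addr0 in sum_cvg.
have -> : (fun k => (x \o d) k - V ((x \o d) k) l) =
    (fun j => (x \o d) j - F ((x \o d) j)) \+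
    (fun j => V ((x \o d) j) ((x \o d) j) - V ((x \o d) j) l).
  by apply/funext => j; rewrite /= FV// addrA subrK.
exact: sum_cvg.
Qed.
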